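(* Let $0<\beta<1$, $\lambda>0$, and let $h_\lambda(\cdot,t)$ denote the probability density of the inverse tempered stable subordinator $E_\lambda(t)$. Then for all $x>0$ and $t>0$, $$h_{\lambda}(x,t) = \frac{1}{\pi} e^{\lambda^{\beta} x -\lambda t}\int_{0}^{\infty}\frac{e^{-ty-xy^{\beta}\cos (\beta\pi)}}{y+\lambda}\left[\lambda^{\beta} \sin\big(xy^{\beta} \sin(\beta\pi)\big) + y^{\beta}\sin\big(\beta\pi- x y^{\beta}\sin(\beta\pi)\big)\right] dy.$$
   Context: For $0<\beta<1$ and $\lambda>0$, the tempered $\beta$-stable subordinator $D_\lambda=(D_\lambda(t))_{t\ge 0}$ with tempering parameter $\lambda$ is the (strictly increasing) subordinator started at $0$ with Laplace transform $\mathbb{E}(e^{-sD_\lambda(t)})=e^{-t((s+\lambda)^{\beta}-\lambda^{\beta})}$ for $s>0$. Equivalently, $D_\lambda(t)$ has density $f_\lambda(x,t)=e^{-\lambda x+\lambda^\beta t}f(x,t)$, $x>0$, where $f(\cdot,t)$ is the density of the $\beta$-stable subordinator $D(t)$ with $\mathbb{E}(e^{-sD(t)})=e^{-ts^\beta}$. The inverse tempered stable (ITS) subordinator is $E_\lambda(t)=\inf\{u>0: D_\lambda(u)>t\}$, $t\ge 0$, and $h_\lambda(x,t)$ denotes the density in $x$ of the random variable $E_\lambda(t)$. *)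

(* Defs.v *)
From HB Require Import structures.
From mathcomp Require Export all_boot all_order all_algebra.
From mathcomp Require Export all_classical all_reals all_analysis.
Export Order.TTheory GRing.Theory Num.Theory.
Export numFieldNormedType.Exports.

Set Implicit Arguments.
Unset Strict Implicit.
Unset Printing Implicit Defensive.

Local Open Scope classical_set_scope.
Local Open Scope ring_scope.

(* Processes are indexed by R; only times t >= 0 are ever constrained or used. *)

Definition stationary_increments (R : realType) (d : measure_display)
    (Omega : measurableType d) (P : probability Omega R)
    (D : R -> {RV P >-> R}) : Prop :=
  forall (s t : R) (A : set R), 0 <= s -> 0 <= t -> measurable A ->
    P [set w | A (D (s + t) w - D s w)] = P [set w | A (D t w - D 0 w)].

(* The product rule over all consecutive increments gives mutual independence:
   subfamilies are obtained by taking some of the A i to be setT. *)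
Definition independent_increments (R : realType) (d : measure_display)
    (Omega : measurableType d) (P : probability Omega R)
    (D : R -> {RV P >-> R}) : Prop :=
  forall (n : nat) (t : nat -> R) (A : nat -> set R),
    0 <= t 0%N ->
    (forall i, (i < n)%N -> t i <= t i.+1) ->
    (forall i, measurable (A i)) ->
    P [set w | forall i, (i < n)%N -> A i (D (t i.+1) w - D (t i) w)] =
    (\prod_(i < n) P [set w | A i (D (t i.+1) w - D (t i) w)%R])%E.

Record subordinator (R : realType) (d : measure_display)
    (Omega : measurableType d) (P : probability Omega R)
    (D : R -> {RV P >-> R}) : Prop := Subordinator {
  subordinator_start : forall w, D 0 w = 0 ;
  subordinator_nondecreasing :
    forall w (s t : R), 0 <= s -> s <= t -> D s w <= D t w ;
  subordinator_right_continuous :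
    forall w (t : R), 0 <= t -> D u w @[u --> t^'+] --> D t w ;
  subordinator_stationary : stationary_increments D ;
  subordinator_independent : independent_increments D }.

Record tempered_stable_subordinator (R : realType) (d : measure_display)
    (Omega : measurableType d) (P : probability Omega R) (beta lambda : R)
    (D : R -> {RV P >-> R}) : Prop := TemperedStableSubordinator {
  tempered_stable_is_subordinator : subordinator D ;
  tempered_stable_laplace : forall t s : R, 0 <= t -> 0 < s ->
    ('E_P[fun w => expR (- s * D t w)] =
     (expR (- t * ((s + lambda) `^ beta - lambda `^ beta)))%:E)%E }.

(* Extended-real valued, so that the infimum of the empty set is +oo. *)
Definition inverse_process (R : realType) (d : measure_display)
    (Omega : measurableType d) (P : probability Omega R)
    (D : R -> {RV P >-> R}) (t : R) (w : Omega) : \bar R :=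
  ereal_inf [set u%:E | u in [set u : R | 0 < u /\ t < D u w]].

(* Taking A := setT shows that X is then almost surely finite. *)
Definition is_density (R : realType) (d : measure_display)
    (Omega : measurableType d) (P : probability Omega R)
    (X : Omega -> \bar R) (f : R -> R) : Prop :=
  [/\ measurable_fun setT f,
      forall x, 0 <= f x &
      forall A : set R, measurable A ->
        P (X @^-1` (EFin @` A)) =
        (\int[@lebesgue_measure R]_(x in A) (f x)%:E)%E].

(* A density is only determined up to a null set; a formula valid at every
   x > 0 refers to the version that is continuous on ]0, +oo[, which is unique
   there. *)
Definition is_ITS_density (R : realType) (d : measure_display)
    (Omega : measurableType d) (P : probability Omega R)
    (D : R -> {RV P >-> R}) (h : R -> R -> R) : Prop :=
  forall t : R, 0 < t ->
    is_density P (inverse_process D t) (fun x => h x t) /\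
    (forall x : R, 0 < x -> {for x, continuous (fun x => h x t)}).

(* Main.v *)
(* Write z^b for the principal power, psi(s) = (s + lambda)^b - lambda^b. For
   fixed x, the distribution function t |-> P(D(x) <= t) has Laplace transform
   e^{-x psi(s)} / s. Cauchy's formula would invert it as
     1 + (1/pi) e^{lambda^b x - lambda t}
           Im int e^{t z - x z^b} / (z - lambda) dz
   over a ray of argument theta. For theta slightly above pi/2, with
   b theta < pi/2, both e^{t z} and e^{-x z^b} decay along the ray, so Fubini
   gives the Laplace transform of this function of t; partial fractions reduce
   it to the case t = 0, that is to the values e^{-x q^b} of Cauchy's integral,
   obtained by rotating the ray towards theta = 0, where the imaginary part of
   1/(z - q) is a Poisson kernel. Uniqueness of the Laplace transform identifies
   the two functions, and for t > 0 the ray may then be rotated to theta = pi,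
   where z^b = r^b e^{i b pi}. Only real analysis is used: rotating a ray is the
   Cauchy-Riemann equation in polar coordinates followed by the mean value
   theorem. Finally P(E(t) > x) = P(D(x) <= t) for all x by continuity in x, and
   minus its x-derivative is the density. *)

From HB Require Import structures.
Require Import Defs.
From mathcomp Require Import measurable_realfun ring lra.

Set Implicit Arguments.
Unset Strict Implicit.
Unset Printing Implicit Defensive.

Local Open Scope classical_set_scope.
Local Open Scope ring_scope.

(** * Derivatives and Lebesgue integrals of real functions *)

(** The inversion integral of e^{-x psi(s)} / s, shifted by z = s + lambda, has its pole at z =
    lambda. Moving the contour to the left of it leaves a residue, which is the summand 1, and two
    conjugate rays, whose difference is 2i times an imaginary part. This only explains where the
    candidate comes from; its Laplace transform is computed directly, so no inversion theorem is
    needed. The obstacle is that no single ray serves every purpose. On the negative half-axis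
    |e^{-x z^b}| = e^{-x r^b cos(b pi)} grows when b > 1/2: only e^{-t r} makes the integral
    converge, and no bound is uniform as t tends to 0. Integrating over t needs such a bound, and an
    angle with b theta < pi/2 < theta provides it. The rotation towards theta = 0 in turn runs into
    the pole q on the positive half-axis; half a residue appears there, as the mass pi of a Poisson
    kernel. *)

Section derivatives.
Context {R : realType}.
Implicit Types (f g : R -> R) (x y a b : R).

Lemma deriv_eq f x a b : is_derive x 1 f a -> a = b -> is_derive x 1 f b.
Proof. by move=> ? <-. Qed.

Lemma deriv_add f g x a b : is_derive x 1 f a -> is_derive x 1 g b ->
  is_derive x 1 (fun y => f y + g y) (a + b).
Proof. by move=> fa gb; exact: is_deriveD. Qed.

Lemma deriv_sub f g x a b : is_derive x 1 f a -> is_derive x 1 g b ->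
  is_derive x 1 (fun y => f y - g y) (a - b).
Proof. by move=> fa gb; exact: is_deriveB. Qed.

Lemma deriv_opp f x a : is_derive x 1 f a ->
  is_derive x 1 (fun y => - f y) (- a).
Proof. by move=> fa; exact: is_deriveN. Qed.

Lemma deriv_mul f g x a b : is_derive x 1 f a -> is_derive x 1 g b ->
  is_derive x 1 (fun y => f y * g y) (f x * b + g x * a).
Proof. by move=> fa gb; exact: is_deriveM. Qed.

Lemma deriv_inv f x a : f x != 0 -> is_derive x 1 f a ->
  is_derive x 1 (fun y => (f y)^-1) (- a / f x ^+ 2).
Proof.
move=> fx0 fa; have := is_deriveV fx0 fa.
by rewrite /GRing.scale/= !mulNr mulrC.
Qed.

Lemma deriv_exp f x a : is_derive x 1 f a ->
  is_derive x 1 (fun y => expR (f y)) (a * expR (f x)).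
Proof.
by move=> fa; have := is_derive1_comp (is_derive_expR (f x)) fa; rewrite mulrC.
Qed.

Lemma deriv_sin f x a : is_derive x 1 f a ->
  is_derive x 1 (fun y => sin (f y)) (a * cos (f x)).
Proof.
by move=> fa; have := is_derive1_comp (is_derive_sin (f x)) fa; rewrite mulrC.
Qed.

Lemma deriv_cos f x a : is_derive x 1 f a ->
  is_derive x 1 (fun y => cos (f y)) (- (a * sin (f x))).
Proof.
by move=> fa; have := is_derive1_comp (is_derive_cos (f x)) fa; rewrite mulNr mulrC.
Qed.

Lemma deriv_atan f x a : is_derive x 1 f a ->
  is_derive x 1 (fun y => atan (f y)) (a / (1 + f x ^+ 2)).
Proof.
by move=> fa; have := is_derive1_comp (is_derive1_atan (f x)) fa; rewrite mulrC.
Qed.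

(** The form [b * x]^ b / x[keeps]x [^ b] as the only power, an atom for [field]. *)
Lemma deriv_pow b x : 0 < x ->
  is_derive x 1 (fun y => y `^ b) (b * x `^ b / x).
Proof.
move=> x0; have := is_derive1_powR b x0.
by rewrite -mulrA powRB ?powRr1 ?(ltW x0) ?(gt_eqF x0) ?implybT.
Qed.

Lemma deriv_sqr f x a : is_derive x 1 f a ->
  is_derive x 1 (fun y => f y ^+ 2) (2 * f x * a).
Proof.
move=> fa; have := deriv_mul fa fa.
rewrite (_ : f x * a + f x * a = 2 * f x * a); last by ring.
by rewrite (_ : (fun y => f y * f y) = (fun y => f y ^+ 2)).
Qed.

Lemma deriv_cst c x : is_derive x 1 (fun=> c : R) 0.
Proof. exact: is_derive_cst. Qed.

Lemma deriv_id x : is_derive x 1 (fun y : R => y) 1.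
Proof. exact: is_derive_id. Qed.

End derivatives.

(* [is_derive] is a type class: resolving the premises as instances would loop or
   produce unsimplified derivatives, hence [notypeclasses]. *)
Ltac deriv_step :=
  match goal with
  | |- is_derive _ _ (fun _ => ?c) _ => exact: deriv_cst
  | |- is_derive _ _ (fun y => y) _ => exact: deriv_id
  | |- is_derive _ _ (fun y => _ + - _) _ => notypeclasses refine (deriv_sub _ _)
  | |- is_derive _ _ (fun y => _ + _) _ => notypeclasses refine (deriv_add _ _)
  | |- is_derive _ _ (fun y => - _) _ => notypeclasses refine (deriv_opp _)
  | |- is_derive _ _ (fun y => _ ^-1) _ => notypeclasses refine (deriv_inv _ _)
  | |- is_derive _ _ (fun y => _ ^+ 2) _ => notypeclasses refine (deriv_sqr _)
  | |- is_derive _ _ (fun y => _ * _) _ => notypeclasses refine (deriv_mul _ _)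
  | |- is_derive _ _ (fun y => expR _) _ => notypeclasses refine (deriv_exp _)
  | |- is_derive _ _ (fun y => sin _) _ => notypeclasses refine (deriv_sin _)
  | |- is_derive _ _ (fun y => cos _) _ => notypeclasses refine (deriv_cos _)
  | |- is_derive _ _ (fun y => atan _) _ => notypeclasses refine (deriv_atan _)
  | |- is_derive ?x ?v ?f ?d =>
      lazymatch f with
      | (fun _ => _) => fail
      | _ => change (is_derive x v (fun y => f y) d)
      end
  | |- is_derive _ _ (fun y => y `^ _) _ => notypeclasses refine (deriv_pow _ _)
  end.
Ltac deriv := notypeclasses refine (deriv_eq _ _); [repeat deriv_step|].

(** * Cauchy integrals along rays *)

Section ray.
Context {R : realType}.
Variables (b x t q : R).
Implicit Types r th : R.

(* On the ray z = r e^{i th}, t z - x z^b = ray_exp + i ray_arg and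
   |z - q|^2 = ray_den. *)
Definition ray_exp r th := t * r * cos th - x * r `^ b * cos (b * th).
Definition ray_arg r th := t * r * sin th - x * r `^ b * sin (b * th).
Definition ray_den r th := r ^+ 2 - 2 * q * r * cos th + q ^+ 2.

(* With G(z) = e^{t z - x z^b} / (z - q), these are the imaginary part of
   e^{i th} G(z) and the real part of z G(z). *)
Definition ray_im r th := expR (ray_exp r th) *
  (r * sin (ray_arg r th) - q * sin (ray_arg r th + th)) / ray_den r th.
Definition ray_re r th := r * expR (ray_exp r th) *
  (r * cos (ray_arg r th) - q * cos (ray_arg r th + th)) / ray_den r th.

(** The th-derivatives of [ray_exp] and [ray_arg]. As t z - x z^b is holomorphic, [ray_darg] is also
    r times the r-derivative of [ray_exp], and [ray_dexp] is - r times that of [ray_arg]. *)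
Definition ray_dexp r th := - (t * r * sin th) + b * x * r `^ b * sin (b * th).
Definition ray_darg r th := t * r * cos th - b * x * r `^ b * cos (b * th).

(* The common value of the th-derivative of [ray_im] and the r-derivative of
   [ray_re]: the Cauchy-Riemann equation in polar coordinates. *)
Definition ray_dim r th := expR (ray_exp r th) *
  ((ray_dexp r th * (r * sin (ray_arg r th) - q * sin (ray_arg r th + th))
    + (r * ray_darg r th * cos (ray_arg r th)
      - q * (ray_darg r th + 1) * cos (ray_arg r th + th))) / ray_den r th
   - (r * sin (ray_arg r th) - q * sin (ray_arg r th + th)) *
     (2 * q * r * sin th) / ray_den r th ^+ 2).

Lemma ray_im_derive r th : ray_den r th != 0 ->
  is_derive th 1 (fun th => ray_im r th) (ray_dim r th).
Proof.
rewrite /ray_den => d0; rewrite /ray_im /ray_exp /ray_arg /ray_den.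
deriv; first exact: d0.
rewrite /ray_dim /ray_dexp /ray_darg /ray_exp /ray_arg /ray_den /=.
by field; exact: d0.
Qed.

Lemma ray_re_derive r th : 0 < r -> ray_den r th != 0 ->
  is_derive r 1 (fun r => ray_re r th) (ray_dim r th).
Proof.
move=> r0; rewrite /ray_den => d0; rewrite /ray_re /ray_exp /ray_arg /ray_den.
deriv; do ?exact: r0; first exact: d0.
rewrite /ray_dim /ray_dexp /ray_darg /ray_exp /ray_arg /ray_den /= !(sinD _ th) !(cosD _ th).
move: (cos2Dsin2 th) d0; set C := cos th; set S := sin th.
set e := expR _; set s := sin (_ - _); set c := cos (_ - _) => CS d0.
(* As rational expressions in [C] and [S] the two sides differ by a multiple of C^2 + S^2 - 1; it is
   displayed here and then removed. *)
transitivity (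
  e * (((- (t * r * S) + b * x * r `^ b * sin (b * th)) *
    (r * s - q * (s * C + c * S)) +
    (r * (t * r * C - b * x * r `^ b * cos (b * th)) * c -
     q * (t * r * C - b * x * r `^ b * cos (b * th) + 1) *
     (c * C - s * S))) /
   (r ^+ 2 - 2 * q * r * C + q ^+ 2) -
   (r * s - q * (s * C + c * S)) * (2 * q * r * S) /
   (r ^+ 2 - 2 * q * r * C + q ^+ 2) ^+ 2) -
   e * (2 * r * c * q ^+ 2 * (C ^+ 2 + S ^+ 2 - 1)) / (r ^+ 2 - 2 * q * r * C + q ^+ 2) ^+ 2).
  by field; rewrite d0 gt_eqF.
by rewrite CS subrr !(mulr0, mul0r) subr0.
Qed.
End ray.

(** * Integrability, limits and derivatives of real-valued Lebesgue integrals *)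

Section real_integrals.
Context {R : realType}.
Local Notation mu := (@lebesgue_measure R).
Implicit Types (f g F : R -> R) (D : set R).

Lemma is_derive_continuous f (x a : R) :
  is_derive x 1 f a -> {for x, continuous f}.
Proof.
by move=> [fx _]; apply/differentiable_continuous; rewrite -derivable1_diffP.
Qed.

Lemma continuous_measurable_itv f (i : interval R) :
  (forall x, x \in i -> {for x, continuous f}) ->
  measurable_fun [set` i] f.
Proof.
move=> cf; apply: subspace_continuous_measurable_fun => //.
by apply: continuous_in_subspaceT => x /set_mem /cf.
Qed.

Lemma Rintegrable_le D f g : measurable D -> measurable_fun D f ->
  mu.-integrable D (EFin \o g) -> (forall x, D x -> `|f x| <= g x) ->
  mu.-integrable D (EFin \o f).
Proof.
move=> mD mf ig fg; apply: (le_integrable _ _ _ ig) => //; first exact/measurable_EFinP.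
by move=> x Dx /=; rewrite lee_fin (le_trans (fg _ Dx)) ?ler_norm.
Qed.

Lemma RintegrableZ D (c : R) f : measurable D ->
  mu.-integrable D (EFin \o f) -> mu.-integrable D (EFin \o (fun x => c * f x)).
Proof.
move=> mD fi; rewrite (_ : EFin \o _ = (fun x => c%:E * (EFin \o f) x)%E).
  exact: integrableZl.
by apply/funext => x /=; rewrite EFinM.
Qed.

Lemma RintegrableD D f g : measurable D ->
  mu.-integrable D (EFin \o f) -> mu.-integrable D (EFin \o g) ->
  mu.-integrable D (EFin \o (fun x => f x + g x)).
Proof.
move=> mD fi gi; rewrite (_ : EFin \o _ = (EFin \o f) \+ (EFin \o g))%E.
  exact: integrableD.
by apply/funext => x /=; rewrite EFinD.
Qed.

Lemma RintegrableB D f g : measurable D ->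
  mu.-integrable D (EFin \o f) -> mu.-integrable D (EFin \o g) ->
  mu.-integrable D (EFin \o (fun x => f x - g x)).
Proof.
move=> mD fi gi; rewrite (_ : EFin \o _ = (EFin \o f) \- (EFin \o g))%E.
  exact: integrableB.
by apply/funext => x /=; rewrite EFinB.
Qed.

Lemma Rintegrable_itv f (a b : R) :
  (forall x, x \in `[a, b] -> {for x, continuous f}) ->
  mu.-integrable `[a, b] (EFin \o f).
Proof.
move=> cf; apply: continuous_compact_integrable; first exact: segment_compact.
by apply: continuous_in_subspaceT => x /set_mem /cf.
Qed.

Lemma Rintegral_FTC f F (a b : R) : a < b ->
  (forall x, x \in `[a, b] -> is_derive x 1 F (f x)) ->
  (forall x, x \in `[a, b] -> {for x, continuous f}) ->
  (\int[mu]_(x in `[a, b]) f x)%R = F b - F a.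
Proof.
move=> ab dF cf; rewrite /Rintegral (@continuous_FTC2 _ _ F)//.
- by apply: continuous_in_subspaceT => x /set_mem /cf.
- have c x : x \in `[a, b] -> F x @[x --> x] --> F x.
    by move=> /dF; exact: is_derive_continuous.
  split.
  + by move=> x /subset_itv_oo_cc /dF [].
  + by apply/cvg_at_right_filter/c; rewrite in_itv/= lexx ltW.
  + by apply/cvg_at_left_filter/c; rewrite in_itv/= lexx ltW.
- by move=> x /subset_itv_oo_cc /dF [_ <-]; rewrite derive1E.
Qed.

Lemma Rintegral_dominated D (f_ : nat -> R -> R) f g : measurable D ->
  (forall n, measurable_fun D (f_ n)) -> measurable_fun D f ->
  {ae mu, forall x, D x -> f_ n x @[n --> \oo] --> f x} ->
  mu.-integrable D (EFin \o g) ->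
  (forall n x, D x -> `|f_ n x| <= g x) ->
  (\int[mu]_(x in D) f_ n x)%R @[n --> \oo] --> (\int[mu]_(x in D) f x)%R.
Proof.
move=> mD mf_ mf ff ig fg.
have [] := @dominated_convergence _ _ R mu D mD (fun n => EFin \o f_ n)
  (EFin \o f) (EFin \o g).
- by move=> n; apply/measurable_EFinP; exact: mf_.
- exact/measurable_EFinP.
- apply: (@filterS _ _ (ae_filter_ringOfSetsType mu) _ _ _ ff).
  by move=> x /[apply] ffx; apply: cvg_EFin => //; exact: nearW.
- by [].
- by apply: aeW => x n Dx; rewrite lee_fin fg.
move=> fi _ cv; apply: fine_cvg; rewrite fineK//.
exact: integrable_fin_num.
Qed.

Lemma is_derive_Rintegral (f df : R -> R -> R) (B : set R)
    (a u v : R) (G : R -> R) :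
  measurable B -> a \in `]u, v[ ->
  (forall x, x \in `]u, v[ -> mu.-integrable B (EFin \o f x)) ->
  (forall x y, x \in `]u, v[ -> B y -> is_derive x 1 (f^~ y) (df x y)) ->
  mu.-integrable B (EFin \o G) ->
  (forall x y, x \in `]u, v[ -> B y -> `|df x y| <= G y) ->
  is_derive a 1 (fun x => \int[mu]_(y in B) f x y)%R
    (\int[mu]_(y in B) df a y)%R.
Proof.
move=> mB aI fi fd Gi dG.
have d1E x y : x \in `]u, v[ -> B y -> partial1of2 f x y = df x y.
  by move=> xI By; rewrite /partial1of2 derive1E; have [_ ->] := fd _ _ xI By.
have fdd x y : `]u, v[%classic x -> B y -> derivable (f^~ y) x 1.
  by move=> xI By; have [] := fd _ _ xI By.
have Gi' : mu.-integrable B (EFin \o (fun y => `|G y|)).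
  exact: (integrable_norm Gi).
have dG' x y : `]u, v[%classic x -> B y -> `|partial1of2 f x y| <= `|G y|.
  by move=> xI By; rewrite d1E// (le_trans (dG _ _ xI By)) ?ler_norm.
have dF := @derivable_under_integral R _ _ mu f B mB a u v aI fi fdd _
  (fun=> normr_ge0 _) Gi' dG'.
split => //; rewrite -derive1E.
rewrite (@differentiation_under_integral R _ _ mu f B mB a u v aI fi fdd _
  (fun=> normr_ge0 _) Gi' dG').
by apply: eq_Rintegral => y /set_mem By; exact: d1E.
Qed.

End real_integrals.

Lemma ler_normM (R : realDomainType) (a b c d : R) :
  `|a| <= c -> `|b| <= d -> `|a * b| <= c * d.
Proof. by move=> ac bd; rewrite normrM ler_pM. Qed.

Lemma ler_normDD (R : realDomainType) (a b c d : R) :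
  `|a| <= c -> `|b| <= d -> `|a + b| <= c + d.
Proof. by move=> ac bd; rewrite (le_trans (ler_normD _ _)) ?lerD. Qed.

Lemma ler_normBD (R : realDomainType) (a b c d : R) :
  `|a| <= c -> `|b| <= d -> `|a - b| <= c + d.
Proof. by move=> ac bd; apply: ler_normDD; rewrite ?normrN. Qed.

(** * Rotation of a truncated ray *)

Section ray_rotation.
Context {R : realType}.
Local Notation mu := (@lebesgue_measure R).
Variables (b x t q : R).
Hypotheses (b0 : 0 < b) (x0 : 0 <= x) (t0 : 0 <= t) (q0 : 0 < q).
Implicit Types r th : R.

Local Notation den := (ray_den q).
Local Notation im := (ray_im b x t q).
Local Notation re := (ray_re b x t q).
Local Notation dim := (ray_dim b x t q).

Lemma ray_denE r th : den r th = (r - q * cos th) ^+ 2 + (q * sin th) ^+ 2.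
Proof. by rewrite /ray_den !exprMn sin2cos2; ring. Qed.

(** For r >= 0 both terms are nonnegative. The first bounds the distance to the pole for r away from
    q at any angle, the second for th away from 0 and r bounded below. *)
Lemma ray_denE2 r th : den r th = (r - q) ^+ 2 + 2 * q * r * (1 - cos th).
Proof. by rewrite /ray_den; ring. Qed.

Lemma ray_den_ge r th : 0 <= r -> (r - q) ^+ 2 <= den r th.
Proof.
move=> r0; rewrite ray_denE2 lerDl mulr_ge0 ?subr_ge0 ?cos_le1//.
by rewrite !mulr_ge0// ltW.
Qed.

Lemma ray_den_ge_cos r th (k : R) : 0 <= r -> cos th <= k ->
  2 * q * r * (1 - k) <= den r th.
Proof.
move=> r0 ck; rewrite ray_denE2 (@le_trans _ _ (2 * q * r * (1 - cos th)))//.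
  by rewrite ler_wpM2l ?lerB// !mulr_ge0// ltW.
by rewrite lerDr sqr_ge0.
Qed.

Lemma ray_den_gt0 r th : 0 < r -> cos th < 1 -> 0 < den r th.
Proof.
move=> r0 c1; apply: lt_le_trans (ray_den_ge_cos (ltW r0) (lexx _)).
by rewrite !mulr_gt0// subr_gt0.
Qed.

Lemma ray_im_num_le r th : 0 <= r ->
  `|r * sin (ray_arg b x t r th) - q * sin (ray_arg b x t r th + th)| <= r + q.
Proof.
move=> r0; rewrite -[leRHS](mulr1 (r + q)) mulrDl; apply: ler_normBD.
- by apply: ler_normM; rewrite ?sin_max// ger0_norm.
- by apply: ler_normM; rewrite ?sin_max// gtr0_norm.
Qed.

Lemma ray_re_num_le r th : 0 <= r ->
  `|r * cos (ray_arg b x t r th) - q * cos (ray_arg b x t r th + th)| <= r + q.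
Proof.
move=> r0; rewrite -[leRHS](mulr1 (r + q)) mulrDl; apply: ler_normBD.
- by apply: ler_normM; rewrite ?cos_max// ger0_norm.
- by apply: ler_normM; rewrite ?cos_max// gtr0_norm.
Qed.

Lemma ray_im_le r th m : 0 <= r -> 0 < m -> m <= den r th ->
  `|im r th| <= expR (ray_exp b x t r th) * (r + q) / m.
Proof.
move=> r0 m0 md; rewrite /ray_im; have d0 := lt_le_trans m0 md.
apply: ler_normM; first apply: ler_normM.
- by rewrite ger0_norm ?expR_ge0.
- exact: ray_im_num_le.
- by rewrite gtr0_norm ?invr_gt0// lef_pV2.
Qed.

Lemma ray_re_le r th m : 0 <= r -> 0 < m -> m <= den r th ->
  `|re r th| <= r * expR (ray_exp b x t r th) * (r + q) / m.
Proof.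
move=> r0 m0 md; rewrite /ray_re; have d0 := lt_le_trans m0 md.
apply: ler_normM; first apply: ler_normM.
- by rewrite ger0_norm ?mulr_ge0 ?expR_ge0.
- exact: ray_re_num_le.
- by rewrite gtr0_norm ?invr_gt0// lef_pV2.
Qed.

Lemma ray_im_continuous r th : 0 < r -> cos th < 1 ->
  {for r, continuous (fun r => im r th)}.
Proof.
move=> r0 c1; have := ray_den_gt0 r0 c1; rewrite /ray_den => /lt0r_neq0 d0.
eapply is_derive_continuous.
rewrite /ray_im /ray_exp /ray_arg /ray_den.
by repeat deriv_step; do ?exact: r0; exact: d0.
Qed.

Lemma ray_dim_continuous r th : 0 < r -> cos th < 1 ->
  {for r, continuous (fun r => dim r th)}.
Proof.
move=> r0 c1; have := ray_den_gt0 r0 c1; rewrite /ray_den => /lt0r_neq0 d0.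
eapply is_derive_continuous.
rewrite /ray_dim /ray_dexp /ray_darg /ray_exp /ray_arg /ray_den.
repeat deriv_step; do ?exact: r0; do ?exact: d0.
by rewrite expf_neq0.
Qed.

(** The majorant for differentiation under the integral. The radii are bounded on both sides, so a
    constant is enough; [k < 1] keeps the ray away from the pole. *)
Lemma ray_dim_bounded (l u k : R) : 0 < l -> k < 1 -> exists G : R,
  forall r th, l <= r <= u -> cos th <= k -> `|dim r th| <= G.
Proof.
move=> l0 k1.
(* [K] dominates [ray_dexp] and [ray_darg]; [m] is the lower bound of [ray_den_ge_cos] at the least
   radius. *)
pose K := t * u + b * x * u `^ b.
pose m := 2 * q * l * (1 - k).
have m0 : 0 < m by rewrite !mulr_gt0// subr_gt0.
exists (expR (t * u + x * u `^ b) *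
  ((K * (u + q) + (u * K + q * (K + 1))) / m + (u + q) * (2 * q * u) / m ^+ 2)).
move=> r th /andP[lr ru] ck.
have r0 : 0 < r := lt_le_trans l0 lr.
have u0 : 0 < u := lt_le_trans r0 ru.
have rb : r `^ b <= u `^ b.
  by rewrite ge0_ler_powR ?nnegrE// ltW.
have md : m <= den r th.
  apply: le_trans (ray_den_ge_cos (ltW r0) ck).
  by rewrite ler_wpM2r ?subr_ge0 ?(ltW k1)// ler_wpM2l// mulr_ge0// ltW.
have d0 := lt_le_trans m0 md.
have Kr : t * r + b * x * r `^ b <= K.
  by rewrite lerD// ler_wpM2l// mulr_ge0// ltW.
have nr : `|r| <= u by rewrite gtr0_norm.
have nq : `|q| <= q by rewrite gtr0_norm.
have nt : `|t * r| <= t * r by rewrite ger0_norm// mulr_ge0// ltW.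
have np : `|b * x * r `^ b| <= b * x * r `^ b.
  by rewrite ger0_norm// !mulr_ge0 ?powR_ge0// ltW.
have ne : `|ray_dexp b x t r th| <= K.
  apply: le_trans Kr; rewrite -[leRHS](mulr1) mulrDl; apply: ler_normDD.
    by rewrite normrN; apply: ler_normM; rewrite ?sin_max.
  by apply: ler_normM; rewrite ?sin_max.
have na : `|ray_darg b x t r th| <= K.
  apply: le_trans Kr; rewrite -[leRHS](mulr1) mulrDl; apply: ler_normBD.
    by apply: ler_normM; rewrite ?cos_max.
  by apply: ler_normM; rewrite ?cos_max.
have ni := ray_im_num_le th (ltW r0).
have {}ni := le_trans ni (lerD ru (lexx q)).
have Vm : `|(den r th)^-1| <= m^-1 by rewrite gtr0_norm ?invr_gt0// lef_pV2.
apply: ler_normM.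
  rewrite ger0_norm ?expR_ge0// ler_expR (le_trans (ler_norm _))//.
  apply: (@le_trans _ _ (t * r * 1 + x * r `^ b * 1)).
    apply: ler_normBD; apply: ler_normM; rewrite ?cos_max//.
    by rewrite ger0_norm// mulr_ge0 ?powR_ge0.
  by rewrite !mulr1 lerD// ler_wpM2l.
apply: ler_normBD.
  apply: ler_normM => //; apply: ler_normDD; first exact: ler_normM.
  apply: ler_normBD.
    rewrite -[leRHS]mulr1; apply: ler_normM; last by rewrite cos_max.
    exact: ler_normM.
  rewrite -[leRHS]mulr1; apply: ler_normM; last by rewrite cos_max.
  by apply: ler_normM => //; apply: ler_normDD => //; rewrite normr1.
rewrite -!exprVn; apply: ler_normM; last first.
  by rewrite !expr2; apply: ler_normM.
apply: ler_normM => //.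
rewrite -[leRHS]mulr1; apply: ler_normM; last by rewrite sin_max.
by apply: ler_normM => //; rewrite ger0_norm// mulr_ge0// ltW.
Qed.

(** The mean value theorem yields the boundary terms at one intermediate angle, so that pointwise
    bounds of [re] at the radii l and u suffice and no integral over an arc occurs. The window ]v,
    w[ leaves room for two-sided derivatives at th1 and th2. *)
Lemma ray_rotation (l u v w th1 th2 k : R) :
  0 < l -> l < u -> k < 1 -> v < th1 -> th1 <= th2 -> th2 < w ->
  (forall th, v < th < w -> cos th <= k) ->
  exists2 th, th1 <= th <= th2 &
    (\int[mu]_(r in `[l, u]) im r th2)%R - (\int[mu]_(r in `[l, u]) im r th1)%R =
    (re u th - re l th) * (th2 - th1).
Proof.
move=> l0 lu k1 vth1 th12 th2w ck.
have [G dG] := ray_dim_bounded u l0 k1.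
have c1 th : v < th < w -> cos th < 1 by move/ck/le_lt_trans; exact.
have dI th : v < th < w -> is_derive th 1
    (fun th => \int[mu]_(r in `[l, u]) im r th)%R (re u th - re l th).
  move=> vw.
  have <- : (\int[mu]_(r in `[l, u]) dim r th)%R = re u th - re l th.
    apply: (@Rintegral_FTC R (dim^~ th) (re^~ th) l u lu) => r;
      rewrite in_itv/= => /andP[lr ru].
    - apply: ray_re_derive; first exact: lt_le_trans lr.
      by rewrite gt_eqF// ray_den_gt0 ?c1// (lt_le_trans l0).
    - by apply: ray_dim_continuous; [exact: lt_le_trans lr|exact: c1].
  apply: (@is_derive_Rintegral R (fun th r => im r th)
    (fun th r => dim r th) `[l, u] th v w (fun=> G)).
  - by [].
  - by rewrite in_itv/=.
  - move=> y yvw; apply: Rintegrable_itv => r.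
    rewrite in_itv/= => /andP[lr ru]; have r0 := lt_le_trans l0 lr.
    by apply: ray_im_continuous => //; exact: c1.
  - move=> y r yvw; rewrite /= in_itv/= => /andP[lr ru].
    have r0 := lt_le_trans l0 lr.
    by apply: ray_im_derive; rewrite gt_eqF// ray_den_gt0// c1.
  - by apply: Rintegrable_itv => r _; exact: cst_continuous.
  - by move=> y r yvw; rewrite /= in_itv/= => lru; apply: dG => //; exact: ck.
have [| |th thI ->] := @MVT_segment R
    (fun th => \int[mu]_(r in `[l, u]) im r th)%R
    (fun th => re u th - re l th) th1 th2 th12.
- move=> th; rewrite in_itv/= => /andP[h1 h2]; apply: dI.
  by rewrite (lt_trans vth1 h1) (lt_trans h2 th2w).
- apply: derivable_within_continuous => th; rewrite in_itv/= => /andP[h1 h2].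
  suff /dI [] : v < th < w by [].
  by rewrite (lt_le_trans vth1 h1) (le_lt_trans h2 th2w).
- by exists th.
Qed.

End ray_rotation.

(** * Decay of the exponential factors *)

Section decay.
Context {R : realType}.
Local Notation mu := (@lebesgue_measure R).
Implicit Types b c x r : R.

(** From e r^b <= e^{e r^b}, raised to the power 1/b, r is at most K e^{c r^b / 4}; the fourth power
    then consumes exactly e^{c r^b}. The choice e = b c / 4 makes the exponents match. *)
Lemma expR_powR_decay b c : 0 < b -> 0 < c -> exists2 C : R, 0 < C &
  forall r, 0 < r -> expR (- (c * r `^ b)) * (1 + r) ^+ 4 <= C.
Proof.
move=> b0 c0; pose e := b * c / 4.
have e0 : 0 < e by rewrite divr_gt0// mulr_gt0.
pose K := e^-1 `^ b^-1.
have K0 : 0 < K by rewrite powR_gt0 ?invr_gt0.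
exists ((1 + K) ^+ 4); first by rewrite exprn_gt0// addr_gt0.
move=> r r0; rewrite expRN mulrC ler_pdivrMr ?expR_gt0//.
have rK : r <= K * expR (c * r `^ b / 4).
  have -> : r = (r `^ b) `^ b^-1.
    by rewrite -powRrM divff ?gt_eqF// powRr1// ltW.
  have -> : expR (c * (r `^ b) `^ b^-1 `^ b / 4) = expR (e * r `^ b) `^ b^-1.
    have -> : (r `^ b) `^ b^-1 = r.
      by rewrite -powRrM divff ?gt_eqF// powRr1// ltW.
    rewrite /powR [in RHS]gt_eqF ?expR_gt0// expRK; congr expR.
    by rewrite /e /powR; field; rewrite gt_eqF.
  rewrite -powRM ?invr_ge0 ?expR_ge0 ?(ltW e0)//.
  apply: ge0_ler_powR; rewrite ?nnegrE ?invr_ge0 ?powR_ge0 ?(ltW b0)//.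
    by rewrite mulr_ge0 ?invr_ge0 ?expR_ge0 ?ltW.
  rewrite mulrC ler_pdivlMr// mulrC.
  by apply: le_trans (expR_ge1Dx _); rewrite lerDr.
have -> : expR (c * r `^ b) = expR (c * r `^ b / 4) ^+ 4.
  by rewrite -expRM_natl; congr expR; field.
have K1 : 0 < 1 + K by rewrite addr_gt0.
rewrite -exprMn ler_pXn2r ?nnegrE ?(addr_ge0 _ (ltW r0)) ?(mulr_ge0 (ltW K1)) ?expR_ge0//.
rewrite mulrDl mul1r lerD// -[leLHS](addr0) (le_trans _ (expR_ge1Dx _))//.
by rewrite lerD2l divr_ge0// mulr_ge0 ?powR_ge0 ?ltW.
Qed.

Lemma powR_sublinear b c x : 0 < b -> b < 1 -> 0 < c -> 0 <= x ->
  (* The inequality x r^b <= c r amounts to r^(1-b) >= x / c, that is to r >= d; below d the left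
     side is at most its value at d. *)
  exists2 M : R, 0 <= M & forall r, 0 < r -> x * r `^ b <= c * r + M.
Proof.
move=> b0 b1 c0 x0; pose d := (x / c) `^ (1 - b)^-1.
exists (x * d `^ b); first by rewrite mulr_ge0 ?powR_ge0.
move=> r r0; have [dr|rd] := leP d r; last first.
  rewrite (@le_trans _ _ (x * d `^ b))//.
    rewrite ler_wpM2l// ge0_ler_powR ?nnegrE ?powR_ge0//; exact: ltW.
  by rewrite lerDr mulr_ge0 ?ltW.
rewrite (@le_trans _ _ (c * r))//; last by rewrite lerDl mulr_ge0 ?powR_ge0.
have xc : x / c <= r `^ (1 - b).
  have -> : x / c = d `^ (1 - b).
    by rewrite /d -powRrM mulVf ?powRr1 ?divr_ge0 ?(ltW c0)// gt_eqF// subr_gt0.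
  rewrite ge0_ler_powR ?nnegrE ?powR_ge0 ?subr_ge0 ?(ltW b1)//; exact: ltW.
have {2}-> : r = r `^ (1 - b) * r `^ b.
  by rewrite -powRD ?subrK ?powRr1 ?(ltW r0)// (gt_eqF r0) implybT.
rewrite mulrA ler_wpM2r ?powR_ge0// mulrC.
by move: xc; rewrite ler_pdivrMr// mulrC.
Qed.

Lemma expR_lin_powR_decay b c x : 0 < b -> b < 1 -> 0 < c -> 0 <= x ->
  exists2 C : R, 0 < C &
  forall r, 0 < r -> expR (- (c * r) + x * r `^ b) * (1 + r) ^+ 4 <= C.
Proof.
(* Half of the linear rate absorbs x r^b, the other half provides the decay. *)
move=> b0 b1 c0 x0; have c2 : 0 < c / 2 by rewrite divr_gt0.
have [M _ Mr] := powR_sublinear b0 b1 c2 x0.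
have [C C0 CP] := @expR_powR_decay 1 (c / 2) ltr01 c2.
exists (expR M * C); first by rewrite mulr_gt0 ?expR_gt0.
move=> r r0; apply: le_trans (ler_wpM2l (expR_ge0 M) (CP _ r0)).
rewrite [leRHS]mulrA -expRD ler_wpM2r ?exprn_ge0 ?addr_ge0 ?(ltW r0)// ler_expR.
by have := Mr _ r0; rewrite powRr1 ?(ltW r0)//; lra.
Qed.

Lemma integrable_inv_sqr :
  mu.-integrable `]0, +oo[ (EFin \o (fun r : R => ((1 + r) ^+ 2)^-1)).
Proof.
pose F (r : R) := - (1 + r)^-1; pose f (r : R) := ((1 + r) ^+ 2)^-1.
have dF (r : R) : 0 <= r -> is_derive r 1 F (f r).
  move=> r0; rewrite /F /f; deriv; first by rewrite gt_eqF// ltr_wpDr.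
  by rewrite /=; field; rewrite gt_eqF// ltr_wpDr.
have cf (r : R) : 0 <= r -> {for r, continuous f}.
  move=> r0; eapply is_derive_continuous; rewrite /f; repeat deriv_step.
  by rewrite gt_eqF// exprn_gt0// ltr_wpDr.
have mf : measurable_fun (`]0, +oo[ : set R) f.
  apply: continuous_measurable_itv => r; rewrite in_itv/= andbT => /ltW.
  exact: cf.
apply/integrableP; split; first exact/measurable_EFinP.
under eq_integral.
  move=> r; rewrite inE/= in_itv/= andbT => r0.
  rewrite ger0_norm ?invr_ge0 ?exprn_ge0 ?addr_ge0 ?(ltW r0)//.
  over.
rewrite integral_itv_obnd_cbnd; last exact/measurable_EFinP.
rewrite (@ge0_continuous_FTC2y _ f F 0 0).
- by rewrite -EFinB ltry.
- by move=> r r0; rewrite /f invr_ge0 exprn_ge0// addr_ge0.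
- apply: continuous_in_subspaceT => r; rewrite inE/= in_itv/= andbT.
  exact: cf.
- rewrite -oppr0; apply: cvgN; apply/gtr0_cvgV0.
    by near=> r; rewrite addr_gt0//; near: r; exact: nbhs_pinfty_gt.
  apply: cvg_addrl; exact: cvg_id.
- by move=> r /ltW /dF [].
- by apply/cvg_at_right_filter; exact: is_derive_continuous (dF _ (lexx 0)).
- by move=> r; rewrite in_itv/= andbT => /ltW /dF [_ <-]; rewrite derive1E.
Unshelve. all: by end_near. Qed.

End decay.

(** * Lipschitz and trigonometric inequalities *)

Section lipschitz_bounds.
Context {R : realType}.
Implicit Types (f df : R -> R) (x y z l u C : R).

Lemma derive_le_lipschitz f df l u C :
  (forall x, x \in `[l, u] -> is_derive x 1 f (df x)) ->
  (forall x, x \in `[l, u] -> `|df x| <= C) ->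
  forall y z, y \in `[l, u] -> z \in `[l, u] -> `|f z - f y| <= C * `|z - y|.
Proof.
move=> dF dC y z.
wlog yz : y z / y <= z => [H yI zI|].
  by have [/H|/ltW/H] := leP y z; [exact|rewrite distrC (distrC z); exact].
rewrite !in_itv/= => /andP[ly yu] /andP[lz zu].
have sub w : w \in `[y, z] -> w \in `[l, u].
  by rewrite !in_itv/= => /andP[yw wz]; rewrite (le_trans ly yw) (le_trans wz zu).
have dF' w : w \in `]y, z[ -> is_derive w 1 f (df w).
  by move=> /subset_itv_oo_cc /sub /dF.
have cF : {within `[y, z], continuous f}.
  by apply: derivable_within_continuous => w /sub /dF [].
have [w wI ->] := MVT_segment yz dF' cF.
by rewrite normrM ler_wpM2r// dC// sub.
Qed.

Lemma norm_sin_le x : `|sin x| <= `|x|.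
Proof.
have I0 : (0 : R) \in `[- `|x|, `|x|] by rewrite in_itv/= oppr_le0 normr_ge0.
have Ix : x \in `[- `|x|, `|x|] by rewrite in_itv/= -ler_norml.
have := derive_le_lipschitz (fun y _ => is_derive_sin y)
  (fun y _ => cos_max y) I0 Ix.
by rewrite sin0 !subr0 mul1r.
Qed.

Lemma norm_cosB1_le x : `|cos x - 1| <= `|x|.
Proof.
have I0 : (0 : R) \in `[- `|x|, `|x|] by rewrite in_itv/= oppr_le0 normr_ge0.
have Ix : x \in `[- `|x|, `|x|] by rewrite in_itv/= -ler_norml.
have sN y : `|- sin y| <= 1 :> R by rewrite normrN sin_max.
have := derive_le_lipschitz (fun y _ => is_derive_cos y) (fun y _ => sN y) I0 Ix.
by rewrite cos0 !subr0 mul1r.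
Qed.

Lemma norm_expRN_le x y : 0 <= x -> 0 <= y ->
  `|expR (- x) - expR (- y)| <= `|x - y|.
Proof.
wlog xy : x y / x <= y => [H x0 y0|x0 y0].
  by have [/H|/ltW/H] := leP x y; [exact|rewrite distrC (distrC x); exact].
rewrite ger0_norm ?subr_ge0 ?ler_expR ?lerN2// distrC ger0_norm ?subr_ge0//.
have -> : expR (- y) = expR (- x) * expR (x - y) by rewrite -expRD; congr expR; ring.
rewrite -[X in X - _]mulr1 -mulrBr -[leRHS]mul1r ler_pM ?expR_ge0//.
- by rewrite subr_ge0 expR_le1 subr_le0.
- by rewrite expR_le1 oppr_le0.
- by have := expR_ge1Dx (x - y); lra.
Qed.

(** In the first quadrant cos x + sin x >= cos^2 x + sin^2 x = 1. Thus sin th alone controls the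
    deviation of a ray from the real axis. *)
Lemma oneBcos_le_sin x : 0 <= x <= pi / 2 -> 1 - cos x <= sin x.
Proof.
move=> /andP[x0 xpi].
have p0 := pi_gt0 R.
have s0 : 0 <= sin x by apply: sin_ge0_pi; rewrite x0/=; lra.
have c0 : 0 <= cos x by apply: cos_ge0_pihalf; rewrite xpi andbT; lra.
have := cos2Dsin2 x; have := sin_le1 x; have := cos_le1 x; nra.
Qed.

Lemma ler_cos_pi x y : 0 <= x -> x <= y -> y <= pi -> cos y <= cos x.
Proof.
move=> x0 xy ypi; rewrite leNgt ltr_cos -?leNgt// in_itv/=.
  by rewrite (le_trans x0).
by rewrite x0 (le_trans xy).
Qed.

Lemma cos_lt1 x : 0 < x -> x <= pi -> cos x < 1.
Proof.
by move=> x0 xpi; rewrite -cos0 ltr_cos// in_itv/= ?lexx ?pi_ge0// ltW.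
Qed.

End lipschitz_bounds.

(** * Improper integrals as limits of truncations *)

Section improper.
Context {R : realType}.
Local Notation mu := (@lebesgue_measure R).

Lemma Rintegral_truncation (f : R -> R) : mu.-integrable `]0, +oo[ (EFin \o f) ->
  (\int[mu]_(r in `[n.+1%:R^-1, n.+1%:R]) f r)%R @[n --> \oo] -->
  (\int[mu]_(r in `]0%R, +oo[) f r)%R.
Proof.
move=> fi; pose I n : set R := `[n.+1%:R^-1, n.+1%:R]%classic.
have sI n : I n `<=` `]0, +oo[%classic.
  move=> r; rewrite /I/= !in_itv/= andbT => /andP[nr _].
  by apply: lt_le_trans nr; rewrite invr_gt0.
have -> : (fun n => \int[mu]_(r in I n) f r)%R =
          (fun n => \int[mu]_(r in `]0%R, +oo[) (f \_ (I n)) r)%R.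
  by apply/funext => n; rewrite -Rintegral_mkcondr setIidr.
have mf : measurable_fun (`]0, +oo[ : set R) f.
  by have /integrableP[/measurable_EFinP] := fi.
apply: (Rintegral_dominated (g := fun r => `|f r|)) => //.
- move=> n; apply/measurable_restrict => //; first exact: measurable_itv.
  by apply: (measurable_funS _ _ mf) => //; exact: subIsetl.
- apply: aeW => r /=; rewrite in_itv/= andbT => r0.
  apply: cvg_near_cst; near=> n.
  rewrite patchE ifT// inE /I/= in_itv/=; apply/andP; split.
    rewrite -[leRHS]invrK lef_pV2 ?posrE ?invr_gt0//.
    rewrite (@le_trans _ _ n%:R) ?ler_nat//.
    by near: n; exact: nbhs_infty_ger.
  rewrite (@le_trans _ _ n%:R) ?ler_nat//.
  by near: n; exact: nbhs_infty_ger.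
- exact: integrable_norm.
- move=> n r _; rewrite patchE; case: ifP => //.
  by rewrite normr0.
Unshelve. all: by end_near. Qed.

(** The error allowed is what the boundary terms of a rotation contribute, [l] at the inner and
    [u^-1] at the outer radius; it vanishes along l = 1/(n+1), u = n+1. *)
Lemma Rintegral_improper (f : R -> R) (v C l0 u0 : R) :
  mu.-integrable `]0, +oo[ (EFin \o f) -> 0 < l0 ->
  (forall l u, 0 < l -> l < l0 -> u0 < u ->
    `|(\int[mu]_(r in `[l, u]) f r)%R - v| <= C * (l + u^-1)) ->
  (\int[mu]_(r in `]0%R, +oo[) f r)%R = v.
Proof.
move=> fi l00 H.
have cv := Rintegral_truncation fi.
suff cw : (\int[mu]_(r in `[n.+1%:R^-1, n.+1%:R]) f r)%R @[n --> \oo] --> v.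
  exact: (cvg_unique _ cv cw).
apply/cvgrPdist_le => /= e e0; near=> n.
rewrite distrC (le_trans (H _ _ _ _ _))//.
- rewrite -[ltRHS]invrK ltf_pV2 ?posrE ?invr_gt0//.
  rewrite (@lt_le_trans _ _ n%:R) ?ler_nat//.
  by near: n; exact: nbhs_infty_gtr.
- rewrite (@lt_le_trans _ _ n%:R) ?ler_nat//.
  by near: n; exact: nbhs_infty_gtr.
- have : `|C| * (n.+1%:R^-1 + n.+1%:R^-1) <= e.
    have -> : `|C| * (n.+1%:R^-1 + n.+1%:R^-1) = `|C| * 2 / n.+1%:R by ring.
    rewrite ler_pdivrMr// [leRHS]mulrC -ler_pdivrMr//.
    rewrite (@le_trans _ _ n%:R) ?ler_nat//.
    by near: n; exact: nbhs_infty_ger.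
  apply: le_trans; rewrite ler_wpM2r ?addr_ge0 ?invr_ge0//.
  exact: ler_norm.
Unshelve. all: by end_near. Qed.

End improper.

(** Minus the imaginary part of e^{i th} / (z - q) at z = r e^{i th}. Hence, at t = 0, [ray_im] plus
    e^{-x q^b} times this kernel is the imaginary part of e^{i th} (e^{-x z^b} - e^{-x q^b}) / (z -
    q), a quotient without singularity at q. *)
Definition poisson_kernel {R : realType} (q r th : R) : R :=
  q * sin th / ray_den q r th.

(** * The limit of the truncated ray integral as the angle tends to 0 *)

Section poisson.
Context {R : realType}.
Local Notation mu := (@lebesgue_measure R).
Variables (b x q : R).
Hypotheses (b0 : 0 < b) (b1 : b < 1) (x0 : 0 <= x) (q0 : 0 < q).
Implicit Types r th : R.

Local Notation den := (ray_den q).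
Local Notation im := (ray_im b x 0 q).
Local Notation g0 := (expR (- (x * q `^ b))).
Local Notation K := (poisson_kernel q).

(* The numerator of the singular part vanishes at z = q to first order, and
   q sin th |r - q cos th| and (q sin th)^2 are at most |z - q|^2, so the bound is
   uniform in th and dominated convergence applies. *)
Lemma poisson_bounded (l u : R) : 0 < l -> l < q -> q < u -> exists C : R,
  forall r th, r \in `[l, u] -> 0 < th < pi / 2 ->
  `|im r th + g0 * K r th| <= C.
Proof.
move=> l0 lq qu; have p0 := pi_gt0 R.
have [L LP] : exists L, forall r, r \in `[l, u] -> `|r `^ b - q `^ b| <= L * `|r - q|.
  exists (b * u `^ b / l) => r rI.
  have dp y : y \in `[l, u] -> is_derive y 1 (fun y => y `^ b) (b * y `^ b / y).
    by rewrite in_itv/= => /andP[ly _]; apply: deriv_pow; exact: lt_le_trans ly.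
  apply: (derive_le_lipschitz dp) => //; last by rewrite in_itv/= !ltW.
  move=> y; rewrite in_itv/= => /andP[ly yu]; have y0 := lt_le_trans l0 ly.
  apply: ler_normM; first rewrite ger0_norm ?mulr_ge0 ?powR_ge0 ?(ltW b0)//.
    rewrite ler_wpM2l ?(ltW b0)// ge0_ler_powR ?nnegrE ?(ltW b0) ?(ltW y0)//.
    exact: ltW (lt_trans l0 (lt_trans lq qu)).
  by rewrite gtr0_norm ?invr_gt0// lef_pV2.
pose U := x * u `^ b.
exists (U / q + (x * `|L| + x * `|L| + (U / q + U / q))) => r th rI /andP[th0 thpi].
have /andP[lr ru] : l <= r <= u by rewrite in_itv in rI.
have r0 := lt_le_trans l0 lr; have u0 := lt_le_trans r0 ru.
have s0 : 0 < sin th by apply: sin_gt0_pi; rewrite th0/=; lra.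
have c1 : 1 - cos th <= sin th by apply: oneBcos_le_sin; rewrite !ltW.
have bth : b * th <= th by rewrite ler_piMl// ltW.
have bth0 : 0 < b * th by rewrite mulr_gt0.
have sb0 : 0 < sin (b * th) by apply: sin_gt0_pi; rewrite bth0/=; lra.
have sb : sin (b * th) <= sin th.
  by rewrite leNgt ltr_sin ?in_itv/= -?leNgt//; apply/andP; split; lra.
have cb1 : 1 - cos (b * th) <= sin th.
  by apply: le_trans sb; apply: oneBcos_le_sin; apply/andP; split; lra.
have cb0 : 0 < cos (b * th) by apply: cos_gt0_pihalf; apply/andP; split; lra.
set a := r - q * cos th; set s := q * sin th.
have s_gt0 : 0 < s by rewrite mulr_gt0.
have dE : den r th = a ^+ 2 + s ^+ 2 by rewrite ray_denE.
have d0 : 0 < den r th by rewrite dE ltr_wpDl ?sqr_ge0// exprn_gt0.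
pose P := x * r `^ b * sin (b * th).
pose E := x * r `^ b * cos (b * th).
have rb0 : 0 <= r `^ b := powR_ge0 _ _.
have rU : x * r `^ b <= U.
  by rewrite ler_wpM2l// ge0_ler_powR ?nnegrE ?(ltW b0) ?(ltW r0) ?(ltW u0).
have PU : `|P| <= U / q * s.
  rewrite (_ : U / q * s = U * sin th); last by rewrite /s; field; rewrite gt_eqF.
  apply: ler_normM; first by rewrite ger0_norm ?mulr_ge0.
  by rewrite gtr0_norm.
have E0 : 0 <= E by rewrite !mulr_ge0// ltW.
(* Here a - i s is e^{i th} times the conjugate of z - q, and e^{-x z^b} = e^{-E} (cos P - i sin
   P). *)
have -> : im r th + g0 * K r th =
    - (expR (- E) * sin P) * (a / den r th) + (g0 - expR (- E) * cos P) * (s / den r th).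
  rewrite /ray_im /ray_exp /ray_arg /poisson_kernel !mul0r !sub0r.
  rewrite sinD sinN cosN -/P -/E /a /s.
  by field; rewrite gt_eqF.
have as_le : s * `|a| <= den r th.
  rewrite dE -(real_normK (num_real a)); have := sqr_ge0 (`|a| - s); nra.
have ss_le : s * s <= den r th by rewrite dE -expr2 lerDr sqr_ge0.
have U0 : 0 <= U by rewrite mulr_ge0 ?powR_ge0.
have eE : `|expR (- E)| <= 1 by rewrite gtr0_norm ?expR_gt0// expR_le1 oppr_le0.
have first_le : `|- (expR (- E) * sin P) * (a / den r th)| <= U / q.
  apply: (@le_trans _ _ (1 * (U / q * s) * (`|a| / den r th))).
    apply: ler_normM; last by rewrite normrM normfV (gtr0_norm d0).
    by rewrite normrN; apply: ler_normM => //; exact: le_trans (norm_sin_le _) PU.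
  rewrite mul1r -mulrA ler_piMr ?divr_ge0 ?(ltW q0)//.
  by rewrite mulrA ler_pdivrMr// mul1r.
apply: ler_normDD first_le _.
(* By [c1] the distance |r - q| is at most |a| + s, so the Lipschitz bound of r^b gives multiples of
   |a| and s; multiplied by s, both are at most a constant times the denominator. *)
have qle : `|r - q| <= `|a| + s.
  have -> : r - q = a - q * (1 - cos th) by rewrite /a; ring.
  apply: ler_normBD => //; rewrite ger0_norm ?mulr_ge0 ?subr_ge0 ?cos_le1 ?(ltW q0)//.
  by rewrite ler_wpM2l ?(ltW q0).
have gE : `|g0 - expR (- E) * cos P| <=
    (x * `|L|) * `|a| + (x * `|L|) * s + (U / q * s + U / q * s).
  have -> : g0 - expR (- E) * cos P =
     (g0 - expR (- E)) - expR (- E) * (cos P - 1) by ring.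
  apply: (@le_trans _ _ (`|x * q `^ b - E| + 1 * (U / q * s))).
    apply: ler_normBD; first exact: norm_expRN_le (mulr_ge0 x0 (powR_ge0 _ _)) E0.
    by apply: ler_normM => //; exact: le_trans (norm_cosB1_le _) PU.
  rewrite mul1r addrA lerD2r.
  have -> : x * q `^ b - E = - (x * (r `^ b - q `^ b)) + x * r `^ b * (1 - cos (b * th)).
    by rewrite /E; ring.
  apply: ler_normDD.
    rewrite normrN -mulrDr -mulrA; apply: ler_normM; first by rewrite ger0_norm.
    apply: le_trans (LP _ rI) _; apply: (@le_trans _ _ (`|L| * `|r - q|)).
      by rewrite ler_wpM2r ?ler_norm.
    by rewrite ler_wpM2l.
  rewrite (_ : U / q * s = U * sin th); last by rewrite /s; field; rewrite gt_eqF.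
  apply: ler_normM; first by rewrite ger0_norm ?mulr_ge0.
  by rewrite ger0_norm// subr_ge0 cos_le1.
apply: (@le_trans _ _ (((x * `|L|) * `|a| + (x * `|L|) * s + (U / q * s + U / q * s))
   * (s / den r th))).
  by apply: ler_normM => //; rewrite ger0_norm// divr_ge0 ?ltW.
rewrite mulrA ler_pdivrMr//.
have xL : 0 <= x * `|L| by rewrite mulr_ge0.
have Uq : 0 <= U / q by rewrite divr_ge0 ?(ltW q0).
have h1 := ler_wpM2l xL as_le; have h2 := ler_wpM2l xL ss_le.
have h3 := ler_wpM2l Uq ss_le.
move: h1 h2 h3; set A := x * `|L|; set B := U / q; set a' := `|a| => h1 h2 h3.
rewrite (_ : (A * a' + A * s + (B * s + B * s)) * s =
   A * (s * a') + A * (s * s) + (B * (s * s) + B * (s * s))); last by ring.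
by rewrite !mulrDl !lerD.
Qed.

Lemma poisson_cvg0 r (th_ : nat -> R) : 0 < r -> r != q ->
  th_ n @[n --> \oo] --> 0 ->
  im r (th_ n) + g0 * K r (th_ n) @[n --> \oo] --> (0 : R).
Proof.
move=> r0 rq th_0.
have d0 : den r 0 != 0.
  by rewrite ray_denE2 cos0 subrr mulr0 addr0 expf_neq0// subr_eq0.
have c : {for 0, continuous (fun th => im r th + g0 * K r th)}.
  eapply is_derive_continuous.
  notypeclasses refine (deriv_add _ _); first exact: ray_im_derive.
  by move: d0; rewrite /poisson_kernel /ray_den => d0; repeat deriv_step.
have e0 : im r 0 + g0 * K r 0 = 0.
  by rewrite /ray_im /ray_arg /poisson_kernel /= !(mul0r, mulr0, sin0, subr0, addr0).
by have := cvg_comp _ _ th_0 c; rewrite e0.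
Qed.

(** An antiderivative in r is atan ((r - q cos th) / (q sin th)). As th decreases to 0 its argument
    tends to +oo at u > q and to -oo at l < q, so each end contributes pi / 2. *)
Lemma poisson_mass (l u : R) (th_ : nat -> R) : 0 < l -> l < q -> q < u ->
  (forall n, 0 < th_ n < pi / 2) -> th_ n @[n --> \oo] --> 0 ->
  (\int[mu]_(r in `[l, u]) K r (th_ n))%R @[n --> \oo] --> (pi : R).
Proof.
move=> l0 lq qu th_pi th_0; have p0 := pi_gt0 R.
have s0 n : 0 < sin (th_ n).
  by have /andP[h1 h2] := th_pi n; apply: sin_gt0_pi; rewrite h1/=; lra.
have c1 n : cos (th_ n) < 1.
  have /andP[h1 h2] := th_pi n.
  by rewrite -cos0 ltr_cos ?in_itv//=; apply/andP; split; lra.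
pose F n r := atan ((r - q * cos (th_ n)) / (q * sin (th_ n))).
have intE n : (\int[mu]_(r in `[l, u]) K r (th_ n))%R = F n u - F n l.
  apply: (@Rintegral_FTC R (fun r => K r (th_ n)) (F n) l u (lt_trans lq qu)).
    move=> r; rewrite in_itv/= => /andP[lr ru]; have r0 := lt_le_trans l0 lr.
    rewrite /F; deriv; rewrite /poisson_kernel ray_denE /=; field.
    rewrite !gt_eqF// ltr_wpDl ?sqr_ge0// exprn_gt0// mulr_gt0//.
  move=> r; rewrite in_itv/= => /andP[lr ru]; have r0 := lt_le_trans l0 lr.
  have := ray_den_gt0 q0 r0 (c1 n); rewrite /ray_den => /lt0r_neq0 d0.
  eapply is_derive_continuous; rewrite /poisson_kernel /ray_den.
  by repeat deriv_step.
have lim (v : R) : v != q ->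
    q * sin (th_ n) / (v - q * cos (th_ n)) @[n --> \oo] --> (0 : R).
  move=> vq.
  have c : {for 0, continuous (fun th => q * sin th / (v - q * cos th))}.
    eapply is_derive_continuous; repeat deriv_step.
    by rewrite cos0 mulr1 subr_eq0.
  have := cvg_comp _ _ th_0 c.
  by rewrite sin0 mulr0 mul0r.
have -> : (fun n => \int[mu]_(r in `[l, u]) K r (th_ n))%R =
   (fun n => F n u + atan ((q * cos (th_ n) - l) / (q * sin (th_ n)))).
  apply/funext => n; rewrite intE -atanN; congr (_ + atan _).
  by field; rewrite !gt_eqF.
rewrite (_ : pi = pi / 2 + pi / 2 :> R); last by field.
have Lu : ((u - q * cos (th_ n)) / (q * sin (th_ n))) @[n --> \oo] --> +oo.
  apply/gtr0_cvgV0.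
    apply: nearW => n; rewrite divr_gt0 ?mulr_gt0// subr_gt0.
    by apply: lt_trans qu; rewrite gtr_pMr.
  apply: (cvg_trans _ (lim u _)); last by rewrite gt_eqF.
  by apply: near_eq_cvg; apply: nearW => n; rewrite /= ?fctE invf_div.
have cn : q * cos (th_ n) @[n --> \oo] --> q.
  have c : {for 0, continuous (fun th => q * cos th)}.
    by eapply is_derive_continuous; repeat deriv_step.
  by have := cvg_comp _ _ th_0 c; rewrite cos0 mulr1.
have Ll : ((q * cos (th_ n) - l) / (q * sin (th_ n))) @[n --> \oo] --> +oo.
  apply/gtr0_cvgV0.
    near=> n; rewrite divr_gt0 ?mulr_gt0// subr_gt0.
    by near: n; exact: (cvgr_gt _ cn _ lq).
  have lq' : l != q by rewrite lt_eqF.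
  have cN := cvgN (FF := eventually_filter) (lim _ lq'); rewrite oppr0 in cN.
  apply: (cvg_trans _ cN).
  apply: near_eq_cvg; apply: nearW => n.
  by rewrite /= ?fctE invf_div -mulrN -invrN opprB.
by apply: cvgD; [exact: (cvg_comp _ _ Lu (@cvgy_atan R))|
                 exact: (cvg_comp _ _ Ll (@cvgy_atan R))].
Unshelve. all: by end_near. Qed.

Lemma poisson_kernel_continuous r th : 0 < r -> cos th < 1 ->
  {for r, continuous (fun r => K r th)}.
Proof.
move=> r0 c1; have := ray_den_gt0 q0 r0 c1; rewrite /ray_den => /lt0r_neq0 d0.
eapply is_derive_continuous; rewrite /poisson_kernel /ray_den.
by repeat deriv_step.
Qed.

(** Splitting off [- g0 * K] leaves a bounded remainder that tends to 0 at every radius except q;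
    the limit is the mass of the part split off. *)
Lemma ray_im_cvg (l u : R) (th_ : nat -> R) : 0 < l -> l < q -> q < u ->
  (forall n, 0 < th_ n < pi / 2) -> th_ n @[n --> \oo] --> 0 ->
  (\int[mu]_(r in `[l, u]) im r (th_ n))%R @[n --> \oo] --> - (pi * g0).
Proof.
move=> l0 lq qu th_pi th_0; have p0 := pi_gt0 R.
have c1 n : cos (th_ n) < 1.
  have /andP[h1 h2] := th_pi n.
  by rewrite -cos0 ltr_cos ?in_itv//=; apply/andP; split; lra.
have [C HC] := poisson_bounded l0 lq qu.
have pos r : r \in `[l, u] -> 0 < r.
  by rewrite in_itv/= => /andP[lr _]; exact: lt_le_trans lr.
have ci n r : r \in `[l, u] -> {for r, continuous (fun r => im r (th_ n))}.
  by move=> /pos r0; exact: ray_im_continuous.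
have cK n r : r \in `[l, u] -> {for r, continuous (fun r => K r (th_ n))}.
  by move=> /pos r0; exact: poisson_kernel_continuous.
have cgK n r : r \in `[l, u] -> {for r, continuous (fun r => g0 * K r (th_ n))}.
  by move=> /(cK n) cKr; apply: cvgM => //; exact: cvg_cst.
have cs n r : r \in `[l, u] ->
    {for r, continuous (fun r => im r (th_ n) + g0 * K r (th_ n))}.
  by move=> rI; apply: cvgD; [exact: ci|exact: cgK].
have -> : (fun n => \int[mu]_(r in `[l, u]) im r (th_ n))%R =
  (fun n => \int[mu]_(r in `[l, u]) (im r (th_ n) + g0 * K r (th_ n)) -
            g0 * \int[mu]_(r in `[l, u]) K r (th_ n))%R.
  apply/funext => n; rewrite RintegralD//; last 2 first.
  - exact: Rintegrable_itv (ci n).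
  - exact: Rintegrable_itv (cgK n).
  by rewrite RintegralZl ?addrK//; exact: Rintegrable_itv (cK n).
rewrite -[X in _ --> X]add0r (mulrC pi); apply: cvgB; last first.
  by apply: cvgM; [exact: cvg_cst|exact: poisson_mass].
have e0 : (\int[mu]_(r in `[l, u]) (fun=> 0 : R) r)%R = 0.
  by rewrite Rintegral_cst ?mul0r.
rewrite -[X in _ --> X]e0.
apply: (@Rintegral_dominated R _ (fun n r => im r (th_ n) + g0 * K r (th_ n))
  (fun=> 0) (fun=> C)) => //.
- by move=> n; apply: continuous_measurable_itv; exact: cs.
- exists [set q]; split; [by []|exact: lebesgue_measure_set1|] => r /=.
  apply: contra_notP => /eqP rq; rewrite in_itv/= => /andP[lr ru].
  by apply: poisson_cvg0 => //; exact: lt_le_trans lr.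
- by apply: Rintegrable_itv => r _; exact: cst_continuous.
- by move=> n r /= rI; apply: HC.
Qed.

End poisson.

(** * Decay estimates along a whole ray *)

Section ray_integrals.
Context {R : realType}.
Local Notation mu := (@lebesgue_measure R).
Variables (b x t q : R).
Hypotheses (b0 : 0 < b) (b1 : b < 1) (x0 : 0 < x) (t0 : 0 <= t) (q0 : 0 < q).
Implicit Types r th : R.

Local Notation den := (ray_den q).
Local Notation im := (ray_im b x t q).
Local Notation re := (ray_re b x t q).
Local Notation E r th := (expR (ray_exp b x t r th)).

(** The bounds [m] and [C] are data because they have different sources: [cos (b * th) > 0] on rays
    with b th < pi / 2, and [cos th < 0] with t > 0 near the negative half-axis. The fourth power
    pays for the numerator and still leaves (1 + r)^-2. *)
Lemma ray_im_decay (C m th r : R) : 0 < m -> 0 < r ->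
  m <= den r th -> E r th * (1 + r) ^+ 4 <= C ->
  `|im r th| <= (1 + q) * C / m * ((1 + r) ^+ 2)^-1.
Proof.
move=> m0 r0 mden EC; apply: le_trans (ray_im_le b x t q0 (ltW r0) m0 mden) _.
have r1 : 0 < 1 + r by rewrite addr_gt0.
rewrite [leRHS]mulrAC ler_wpM2r ?invr_ge0 ?(ltW m0)// ler_pdivlMr ?exprn_gt0//.
apply: (@le_trans _ _ ((1 + q) * (E r th * (1 + r) ^+ 4))); last first.
  by rewrite ler_wpM2l// addr_ge0// ltW.
have := expR_gt0 (ray_exp b x t r th); set e := expR _ => e0.
rewrite -subr_ge0.
have -> : (1 + q) * (e * (1 + r) ^+ 4) - e * (r + q) * (1 + r) ^+ 2 =
  e * (1 + r) ^+ 2 * ((1 + q) * (1 + r) ^+ 2 - (r + q)) by ring.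
rewrite mulr_ge0 ?mulr_ge0 ?exprn_ge0 ?(ltW e0) ?(ltW r1)//.
have -> : (1 + q) * (1 + r) ^+ 2 - (r + q) =
  1 + r + 2 * q * r + r ^+ 2 + q * r ^+ 2 by ring.
by rewrite !addr_ge0 ?mulr_ge0 ?exprn_ge0 ?(ltW r0) ?(ltW q0).
Qed.

(** The two bounds serve the two boundary terms of a rotation, the first at the inner radius and the
    second at the outer one. *)
Lemma ray_re_decay (C m th r : R) : 0 < m -> 0 < r ->
  m <= den r th -> E r th * (1 + r) ^+ 4 <= C ->
  `|re r th| <= (1 + q) * C / m * r /\ `|re r th| <= (1 + q) * C / m / r.
Proof.
move=> m0 r0 mden EC.
have := ray_re_le b x t q0 (ltW r0) m0 mden.
have r1 : 0 < 1 + r by rewrite addr_gt0.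
have := expR_gt0 (ray_exp b x t r th); set e := expR _ in EC * => e0 H.
have qC : (1 + q) * (e * (1 + r) ^+ 4) <= (1 + q) * C.
  by rewrite ler_wpM2l// addr_ge0// ltW.
split; apply: le_trans H _.
  rewrite [leRHS]mulrAC ler_wpM2r ?invr_ge0 ?(ltW m0)//.
  apply: (@le_trans _ _ ((1 + q) * (e * (1 + r) ^+ 4) * r)); last first.
    by rewrite ler_wpM2r// ltW.
  rewrite -subr_ge0.
  have -> : (1 + q) * (e * (1 + r) ^+ 4) * r - r * e * (r + q) =
    e * r * ((1 + q) * (1 + r) ^+ 4 - (r + q)) by ring.
  rewrite mulr_ge0 ?mulr_ge0 ?(ltW e0) ?(ltW r0)//.
  have -> : (1 + q) * (1 + r) ^+ 4 - (r + q) = 1 + 3 * r + 4 * q * r +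
    (1 + q) * (6 * r ^+ 2 + 4 * r ^+ 3 + r ^+ 4) by ring.
  by rewrite !(addr_ge0, mulr_ge0) ?exprn_ge0 ?(ltW r0) ?(ltW q0).
rewrite [leRHS]mulrAC ler_wpM2r ?invr_ge0 ?(ltW m0)// ler_pdivlMr//.
apply: le_trans qC; rewrite -subr_ge0.
have -> : (1 + q) * (e * (1 + r) ^+ 4) - r * e * (r + q) * r =
  e * ((1 + q) * (1 + r) ^+ 4 - r * (r * (r + q))) by ring.
rewrite mulr_ge0 ?(ltW e0)//.
have -> : (1 + q) * (1 + r) ^+ 4 - r * (r * (r + q)) = 1 + 4 * r + 6 * r ^+ 2 +
  3 * r ^+ 3 + r ^+ 4 + q * (1 + 4 * r + 5 * r ^+ 2 + 4 * r ^+ 3 + r ^+ 4) by ring.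
by rewrite !(addr_ge0, mulr_ge0) ?exprn_ge0 ?(ltW r0) ?(ltW q0).
Qed.

Lemma ray_im_integrable (C m th : R) : cos th < 1 -> 0 < m ->
  (forall r, 0 < r -> m <= den r th) ->
  (forall r, 0 < r -> E r th * (1 + r) ^+ 4 <= C) ->
  mu.-integrable `]0, +oo[ (EFin \o (fun r => im r th)).
Proof.
move=> c1 m0 mden EC.
apply: (Rintegrable_le (g := fun r => (1 + q) * C / m * ((1 + r) ^+ 2)^-1)) => //.
- apply: continuous_measurable_itv => r; rewrite in_itv/= andbT => r0.
  exact: ray_im_continuous.
- by apply: RintegrableZ => //; exact: integrable_inv_sqr.
- move=> r; rewrite /= in_itv/= andbT => r0.
  by apply: ray_im_decay => //; [exact: mden|exact: EC].
Qed.

End ray_integrals.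

(** * Cauchy's integral for e^{-x q^b} *)

Section stieltjes.
Context {R : realType}.
Local Notation mu := (@lebesgue_measure R).
Variables (b x q th0 : R).
Hypotheses (b0 : 0 < b) (b1 : b < 1) (x0 : 0 < x) (q0 : 0 < q).
Hypotheses (th0_gt0 : 0 < th0) (th0_pi : th0 < pi) (bth0 : b * th0 < pi / 2).
Implicit Types r th : R.

Lemma cos_ray_gt0 th : 0 <= th -> th <= th0 ->
  0 < cos (b * th0) /\ cos (b * th0) <= cos (b * th).
Proof.
move=> th_ge0 thth; have p0 := pi_gt0 R.
have hb := bth0; have bt : 0 < b * th0 by rewrite mulr_gt0.
have bt' : 0 <= b * th by rewrite mulr_ge0 ?(ltW b0).
have btt : b * th <= b * th0 by rewrite ler_wpM2l ?(ltW b0).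
split; first by apply: cos_gt0_pihalf; apply/andP; split; lra.
by apply: ler_cos_pi; lra.
Qed.

Lemma ray_exp0_decay : exists2 C : R, 0 < C & forall r th, 0 < r ->
  0 <= th -> th <= th0 -> expR (ray_exp b x 0 r th) * (1 + r) ^+ 4 <= C.
Proof.
have [c0 _] := cos_ray_gt0 (ltW th0_gt0) (lexx _).
have [C C0 HC] := expR_powR_decay b0 (mulr_gt0 x0 c0).
exists C => // r th r0 th_ge0 thth; apply: le_trans (HC _ r0).
rewrite ler_wpM2r ?exprn_ge0 ?addr_ge0 ?(ltW r0)//.
rewrite ler_expR /ray_exp !mul0r sub0r lerN2 [leLHS]mulrAC.
rewrite ler_wpM2l ?mulr_ge0 ?powR_ge0 ?(ltW x0)//.
by have [] := cos_ray_gt0 th_ge0 thth.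
Qed.

Lemma ray_den_gt0_uniform : exists2 m : R, 0 < m & forall r, m <= ray_den q r th0.
Proof.
have s0 : 0 < sin th0 by apply: sin_gt0_pi; rewrite th0_gt0.
exists ((q * sin th0) ^+ 2); first by rewrite exprn_gt0// mulr_gt0.
by move=> r; rewrite ray_denE lerDr sqr_ge0.
Qed.

Lemma stieltjes_integrable :
  mu.-integrable `]0, +oo[ (EFin \o (fun r => ray_im b x 0 q r th0)).
Proof.
have [C C0 HC] := ray_exp0_decay.
have [m m0 mden] := ray_den_gt0_uniform.
exact: (ray_im_integrable q0 (cos_lt1 th0_gt0 (ltW th0_pi)) m0
  (fun r _ => mden r) (fun r h => HC r th0 h (ltW th0_gt0) (lexx _))).
Qed.

(* Near the end points of [l, u] the rotation costs O(l + 1/u) uniformly in the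
   angle, which allows to let th tend to 0 before l to 0 and u to infinity. *)
Lemma stieltjes :
  (\int[mu]_(r in `]0%R, +oo[) ray_im b x 0 q r th0)%R =
  - (pi * expR (- (x * q `^ b))).
Proof.
have p0 := pi_gt0 R; have hq := q0; have ht := th0_gt0; have ht' := th0_pi.
have [C C0 HC] := ray_exp0_decay.
(* Since l < q/2 and u > 2q, |z - q| >= |r - q| >= q/2 at both ends, whatever the angle. *)
pose m := (q / 2) ^+ 2.
have m0 : 0 < m by rewrite exprn_gt0// divr_gt0.
pose K := (1 + q) * C / m.
have K0 : 0 <= K by rewrite divr_ge0 ?mulr_ge0 ?addr_ge0 ?(ltW q0) ?(ltW C0) ?(ltW m0).
apply: (@Rintegral_improper _ _ _ (pi * K) (q / 2) (2 * q)).
- exact: stieltjes_integrable.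
- by rewrite divr_gt0.
move=> l u l0 lq qu.
have lq' : l < q by lra.
have qu' : q < u by lra.
have u0 : 0 < u by lra.
(* The shift by 2 keeps these angles at most th0 / 2, hence below pi / 2. *)
pose th_ n : R := th0 / n.+2%:R.
have th_gt0 n : 0 < th_ n by rewrite divr_gt0.
have th_le n : th_ n <= th0 / 2.
  by rewrite ler_pM2l// lef_pV2 ?posrE// ler_nat.
have th_cvg : th_ n @[n --> \oo] --> 0.
  rewrite -(mulr0 th0); apply: cvgM; first exact: cvg_cst.
  apply/gtr0_cvgV0; first exact: nearW.
  have := @cvgr_idn R; rewrite -(cvg_shiftn 2); apply: cvg_trans.
  by apply: near_eq_cvg; apply: nearW => n /=; rewrite addn2.
have ci := ray_im_cvg b0 b1 (ltW x0) q0 l0 lq' qu' _ th_cvg.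
have {}ci : (\int[mu]_(r in `[l, u]) ray_im b x 0 q r (th_ n))%R
    @[n --> \oo] --> - (pi * expR (- (x * q `^ b))).
  by apply: ci => n; rewrite th_gt0/=; have := th_le n; lra.
have bound n : `|(\int[mu]_(r in `[l, u]) ray_im b x 0 q r th0)%R -
    (\int[mu]_(r in `[l, u]) ray_im b x 0 q r (th_ n))%R| <= pi * K * (l + u^-1).
  have tn := th_le n; have tn0 := th_gt0 n.
  (* The window ]th_n / 2, pi[ and the constant cos (th_n / 2) degenerate as n grows, but do not
     enter the boundary terms: the bound is uniform in n. *)
  have [||||||th /andP[th1 th2] ->] := @ray_rotation R b x 0 q b0 (ltW x0) (lexx _) q0
    l u (th_ n / 2) pi (th_ n) th0 (cos (th_ n / 2)) l0 => //.
  - by lra.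
  - by apply: cos_lt1; lra.
  - by lra.
  - by lra.
  - move=> th /andP[h1 h2].
    by apply: ler_cos_pi; lra.
  have den_l : m <= ray_den q l th.
    apply: le_trans (ray_den_ge q0 _ (ltW l0)).
    rewrite /m -(sqrrN (l - q)) ler_pXn2r ?nnegrE//; lra.
  have den_u : m <= ray_den q u th.
    apply: le_trans (ray_den_ge q0 _ (ltW u0)).
    rewrite /m ler_pXn2r ?nnegrE//; lra.
  have th_ge0 : 0 <= th by apply: le_trans th1; exact: ltW.
  have [rl _] := ray_re_decay q0 m0 l0 den_l (HC _ _ l0 th_ge0 th2).
  have [_ ru] := ray_re_decay q0 m0 u0 den_u (HC _ _ u0 th_ge0 th2).
  rewrite (_ : pi * K * (l + u^-1) = (K / u + K * l) * pi); last by ring.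
  apply: ler_normM; first exact: ler_normBD.
  by rewrite ger0_norm; lra.
apply/ler_addgt0Pr => e e0.
have /cvgrPdist_le/(_ _ e0) [N _ HN] := ci.
have := HN N (leqnn _); rewrite distrC => hN.
have -> : (\int[mu]_(r in `[l, u]) ray_im b x 0 q r th0)%R -
   - (pi * expR (- (x * q `^ b))) =
  ((\int[mu]_(r in `[l, u]) ray_im b x 0 q r th0)%R -
    (\int[mu]_(r in `[l, u]) ray_im b x 0 q r (th_ N))%R) +
  ((\int[mu]_(r in `[l, u]) ray_im b x 0 q r (th_ N))%R -
   - (pi * expR (- (x * q `^ b)))) by ring.
exact: ler_normDD.
Qed.

End stieltjes.

(** * Rotation to the negative half-axis for t > 0 *)

Section tilt.
Context {R : realType}.
Local Notation mu := (@lebesgue_measure R).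
Variables (b x t q th0 : R).
Hypotheses (b0 : 0 < b) (b1 : b < 1) (x0 : 0 < x) (t0 : 0 < t) (q0 : 0 < q).
Hypotheses (th0_pihalf : pi / 2 < th0) (th0_pi : th0 <= pi).
Implicit Types r th : R.

(** Here cos th <= cos th0 < 0, so the linear term t r cos th beats x r^b, whatever the sign of
    [cos (b * th)]. *)
Lemma ray_exp_decay : exists2 C : R, 0 < C & forall r th, 0 < r ->
  th0 <= th -> th <= pi -> expR (ray_exp b x t r th) * (1 + r) ^+ 4 <= C.
Proof.
have p0 := pi_gt0 R; have ht := th0_pihalf; have ht' := th0_pi.
have c0 : 0 < - cos th0.
  by rewrite oppr_gt0 -cos_pihalf ltr_cos ?in_itv/=; [|apply/andP; split..]; lra.
have [C C0 HC] := expR_lin_powR_decay b0 b1 (mulr_gt0 t0 c0) (ltW x0).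
exists C => // r th r0 thth thpi; apply: le_trans (HC _ r0).
rewrite ler_wpM2r ?exprn_ge0 ?addr_ge0 ?(ltW r0)// ler_expR /ray_exp.
rewrite mulrN mulNr opprK; apply: lerD.
  rewrite mulrAC ler_wpM2r ?(ltW r0)// ler_wpM2l ?(ltW t0)//.
  by apply: ler_cos_pi; lra.
by rewrite -mulrN -[leRHS]mulr1 ler_wpM2l ?mulr_ge0 ?powR_ge0 ?(ltW x0)// lerNl cos_geN1.
Qed.

Lemma ray_den_left r th : 0 <= r -> th0 <= th -> th <= pi ->
  q ^+ 2 <= ray_den q r th.
Proof.
move=> r0 thth thpi; have p0 := pi_gt0 R; have ht := th0_pihalf.
have c0 : cos th <= 0.
  by rewrite -cos_pihalf; apply: ler_cos_pi; lra.
rewrite /ray_den lerDr addr_ge0 ?sqr_ge0// -mulrN mulr_ge0 ?oppr_ge0//.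
by rewrite !mulr_ge0// ltW.
Qed.

Lemma ray_im_integrable_left th : th0 <= th -> th <= pi ->
  mu.-integrable `]0, +oo[ (EFin \o (fun r => ray_im b x t q r th)).
Proof.
move=> thth thpi; have [C C0 HC] := ray_exp_decay.
have p0 := pi_gt0 R; have ht := th0_pihalf.
have c1 : cos th < 1 by apply: cos_lt1; lra.
exact: (ray_im_integrable q0 c1 (exprn_gt0 2 q0)
  (fun r h => ray_den_left (ltW h) thth thpi)
  (fun r h => HC r th h thth thpi)).
Qed.

Lemma ray_integral_left :
  (\int[mu]_(r in `]0%R, +oo[) ray_im b x t q r th0)%R =
  (\int[mu]_(r in `]0%R, +oo[) ray_im b x t q r pi)%R.
Proof.
have p0 := pi_gt0 R; have ht := th0_pihalf; have ht' := th0_pi.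
have [C C0 HC] := ray_exp_decay.
have q20 : 0 < q ^+ 2 by rewrite exprn_gt0.
pose K := (1 + q) * C / q ^+ 2.
have K0 : 0 <= K by rewrite divr_ge0 ?mulr_ge0 ?addr_ge0 ?(ltW q0) ?(ltW C0) ?(ltW q20).
have I0 := ray_im_integrable_left (lexx _) th0_pi.
have Ip := ray_im_integrable_left th0_pi (lexx _).
apply/eqP; rewrite -subr_eq0 -RintegralB//; apply/eqP.
apply: (@Rintegral_improper _ _ _ (pi * K) 1 1) => //.
  exact: RintegrableB.
move=> l u l0 l1 u1; have u0 : 0 < u by lra.
have sub : `[l, u] `<=` (`]0, +oo[ : set R).
  by move=> r /=; rewrite !in_itv/= andbT => /andP[lr _]; exact: lt_le_trans lr.
rewrite RintegralB//; last 2 first.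
- by apply: integrableS I0.
- by apply: integrableS Ip.
rewrite subr0 distrC.
(* The rotation ends at pi itself, so the window has to extend beyond it: on ]pi/2, 3 pi/2[ the
   cosine is at most 0. *)
have [||||||th /andP[th1 th2] ->] := @ray_rotation R b x t q b0 (ltW x0) (ltW t0) q0
    l u (pi / 2) (pi + pi / 2) th0 pi 0 l0 => //.
- by lra.
- by lra.
- move=> th /andP[h1 h2]; have := cos_ge0_pihalf (x := th - pi).
  rewrite cosB cospi sinpi mulr0 addr0 mulrN1 oppr_ge0; apply; apply/andP; split; lra.
have dl := ray_den_left (ltW l0) th1 th2.
have du := ray_den_left (ltW u0) th1 th2.
have [rl _] := ray_re_decay q0 q20 l0 dl (HC _ _ l0 th1 th2).
have [_ ru] := ray_re_decay q0 q20 u0 du (HC _ _ u0 th1 th2).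
rewrite (_ : pi * K * (l + u^-1) = (K / u + K * l) * pi); last by ring.
  apply: ler_normM; first exact: ler_normBD.
by rewrite ger0_norm; lra.
Qed.

Lemma ray_im_pi r : 0 < r -> ray_im b x t q r pi =
  - (expR (- (t * r) - x * r `^ b * cos (b * pi)) *
     sin (x * r `^ b * sin (b * pi)) / (r + q)).
Proof.
move=> r0; have rq : 0 < r + q by rewrite addr_gt0.
rewrite /ray_im /ray_exp /ray_arg /ray_den sinpi cospi !mulr0 sub0r sinDpi sinN.
rewrite !mulrN1 opprK; field.
rewrite (gt_eqF rq)/= (_ : _ + _ + _ = (r + q) ^+ 2); last by ring.
by rewrite expf_neq0 ?gt_eqF.
Qed.

End tilt.

(** * Laplace transforms *)

Section laplace_integrals.
Context {R : realType}.
Local Notation mu := (@lebesgue_measure R).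
Implicit Types (s t a c phi : R).

Lemma integrable_expRN a : 0 < a ->
  mu.-integrable `]0, +oo[ (EFin \o (fun t => expR (- (a * t)))).
Proof.
move=> a0; have [C C0 HC] := expR_powR_decay ltr01 a0.
apply: (Rintegrable_le (g := fun r => C * ((1 + r) ^+ 2)^-1)) => //.
- apply: continuous_measurable_itv => r _.
  by eapply is_derive_continuous; repeat deriv_step.
- by apply: RintegrableZ => //; exact: integrable_inv_sqr.
move=> r /=; rewrite in_itv/= andbT => r0; have r1 : 0 < 1 + r by rewrite addr_gt0.
rewrite ger0_norm ?expR_ge0// ler_pdivlMr ?exprn_gt0//.
have := HC _ r0; rewrite powRr1 ?(ltW r0)//; apply: le_trans.
by rewrite ler_wpM2l ?expR_ge0// ler_weXn2l// lerDl ltW.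
Qed.

Lemma integrable_expRN_mul a M (f : R -> R) : 0 < a ->
  measurable_fun (`]0, +oo[ : set R) f -> (forall t, 0 < t -> `|f t| <= M) ->
  mu.-integrable `]0, +oo[ (EFin \o (fun t => expR (- (a * t)) * f t)).
Proof.
move=> a0 mf fM.
apply: (Rintegrable_le (g := fun t => M * expR (- (a * t)))) => //.
- apply: measurable_funM => //; apply: continuous_measurable_itv => r _.
  by eapply is_derive_continuous; repeat deriv_step.
- by apply: RintegrableZ => //; exact: integrable_expRN.
move=> t /=; rewrite in_itv/= andbT => t0.
rewrite mulrC; apply: ler_normM; first exact: fM.
by rewrite ger0_norm ?expR_ge0.
Qed.

Lemma Rintegral_FTC0y (f F : R -> R) :
  mu.-integrable `]0, +oo[ (EFin \o f) ->
  (forall t, is_derive t 1 F (f t)) -> continuous f ->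
  F n%:R @[n --> \oo] --> (0 : R) ->
  (\int[mu]_(t in `]0%R, +oo[) f t)%R = - F 0.
Proof.
move=> fi dF cf F0.
have cv := Rintegral_truncation fi.
suff cw : (\int[mu]_(r in `[n.+1%:R^-1, n.+1%:R]) f r)%R @[n --> \oo] --> - F 0.
  exact: (cvg_unique _ cv cw).
have cn : (n.+1%:R^-1 : R) @[n --> \oo] --> 0 by exact: cvg_harmonic.
have c0 : F n.+1%:R^-1 @[n --> \oo] --> F 0.
  exact: (cvg_comp _ _ cn (is_derive_continuous (dF 0))).
have cN : F n.+1%:R @[n --> \oo] --> (0 : R).
  by move: F0; rewrite -(cvg_shiftn 1); under eq_fun do rewrite addn1.
have := cvgB (FF := eventually_filter) cN c0; rewrite sub0r.
apply: cvg_trans; apply: near_eq_cvg.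
near=> n.
have n1 : (n.+1%:R^-1 : R) < n.+1%:R.
  apply: (@lt_trans _ _ 1); last by rewrite ltr1n ltnS; near: n; exact: nbhs_infty_gt.
  rewrite invf_lt1// ltr1n ltnS; near: n; exact: nbhs_infty_gt.
by rewrite (@Rintegral_FTC R f F _ _ n1 (fun t _ => dF t) (fun t _ => cf t)).
Unshelve. all: by end_near. Qed.

Lemma cvg_expRN a : 0 < a -> expR (- (a * n%:R)) @[n --> \oo] --> (0 : R).
Proof.
move=> a0; have := @cvg_expr R (expR (- a)); rewrite gtr0_norm ?expR_gt0//.
rewrite expR_lt1 oppr_lt0 => /(_ a0); apply: cvg_trans; apply: near_eq_cvg.
by apply: nearW => n; rewrite -expRM_natl mulrN mulrC.
Qed.

Lemma laplace_cst a : 0 < a ->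
  (\int[mu]_(t in `]0%R, +oo[) expR (- (a * t)))%R = a^-1.
Proof.
move=> a0; pose F t := - (a^-1 * expR (- (a * t))).
transitivity (- F 0); last by rewrite /F mulr0 oppr0 expR0 mulr1 opprK.
apply: (@Rintegral_FTC0y (fun t => expR (- (a * t))) F); rewrite /F.
- exact: integrable_expRN.
- move=> t; deriv => /=; field; exact: lt0r_neq0.
- by move=> t; eapply is_derive_continuous; repeat deriv_step.
- rewrite -oppr0 -[X in - X](mulr0 a^-1); apply: cvgN; apply: cvgM.
    exact: cvg_cst.
  exact: cvg_expRN.
Qed.

(** The antiderivative is the imaginary part of that of a complex exponential; the phase lets one
    formula serve both sines of [ray_im]. *)
Lemma laplace_sin a c phi : 0 < a ->
  (\int[mu]_(t in `]0%R, +oo[) (expR (- (a * t)) * sin (c * t + phi)))%R =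
  (a * sin phi + c * cos phi) / (a ^+ 2 + c ^+ 2).
Proof.
move=> a0; have d0 : a ^+ 2 + c ^+ 2 != 0.
  by rewrite gt_eqF// ltr_wpDr ?sqr_ge0// exprn_gt0.
pose F t := - (expR (- (a * t)) *
  ((a * sin (c * t + phi) + c * cos (c * t + phi)) / (a ^+ 2 + c ^+ 2))).
transitivity (- F 0); last by rewrite /F !mulr0 oppr0 expR0 mul1r opprK add0r.
apply: (@Rintegral_FTC0y (fun t => expR (- (a * t)) * sin (c * t + phi)) F).
- apply: (@integrable_expRN_mul _ 1) => //; last by move=> t _; exact: sin_max.
  apply: continuous_measurable_itv => r _.
  by eapply is_derive_continuous; repeat deriv_step.
- by move=> t; rewrite /F; deriv => /=; field.
- by move=> t; eapply is_derive_continuous; repeat deriv_step.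
- have K t : `|F t| <= expR (- (a * t)) * ((`|a| + `|c|) / (a ^+ 2 + c ^+ 2)).
    rewrite /F normrN; apply: ler_normM; first by rewrite ger0_norm ?expR_ge0.
    apply: ler_normM; last first.
      by rewrite ger0_norm// invr_ge0 addr_ge0 ?sqr_ge0.
    rewrite -[leRHS]mulr1 mulrDl; apply: ler_normDD; apply: ler_normM => //.
      exact: sin_max.
    exact: cos_max.
  apply: norm_cvg0; apply: (@squeeze_cvgr _ _ _ _ (fun=> 0)
    (fun n => expR (- (a * n%:R)) * ((`|a| + `|c|) / (a ^+ 2 + c ^+ 2)))).
  + by apply: nearW => n; rewrite normr_ge0 K.
  + exact: cvg_cst.
  + rewrite -[X in _ --> X](mul0r ((`|a| + `|c|) / (a ^+ 2 + c ^+ 2))).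
    by apply: cvgM; [exact: cvg_expRN|exact: cvg_cst].
Qed.

End laplace_integrals.

(** * Uniqueness of the Laplace transform *)

Section laplace_uniqueness.
Context {R : realType}.
Local Notation mu := (@lebesgue_measure R).

(** With y = e^{-t}, a factor 1 - (y - y0)^2 turns the weight y^(k+1) into a combination of y^(k+1),
    y^(k+2) and y^(k+3); hence the induction on [N] with [k] general. The exponents stay positive,
    as the hypothesis on f requires. *)
Lemma laplace_kernel_power (f : R -> R) (M y0 : R) (N k : nat) :
  measurable_fun (`]0, +oo[ : set R) f -> (forall t, 0 < t -> `|f t| <= M) ->
  (forall s, 0 < s -> (\int[mu]_(t in `]0%R, +oo[) (expR (- (s * t)) * f t))%R = 0) ->
  let g t := expR (- (k.+1%:R * t)) * ((1 - (expR (- t) - y0) ^+ 2) ^+ N * f t) in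
  mu.-integrable `]0, +oo[ (EFin \o g) /\ (\int[mu]_(t in `]0%R, +oo[) g t)%R = 0.
Proof.
move=> mf fM f0; elim: N k => [|N IH] k /=.
  have gE t : expR (- (k.+1%:R * t)) * ((1 - (expR (- t) - y0) ^+ 2) ^+ 0 * f t) =
      expR (- (k.+1%:R * t)) * f t by rewrite expr0 mul1r.
  rewrite (funext gE); split; last exact: f0.
  exact: integrable_expRN_mul fM.
pose g j t := expR (- (j.+1%:R * t)) * ((1 - (expR (- t) - y0) ^+ 2) ^+ N * f t).
have gE t : expR (- (k.+1%:R * t)) * ((1 - (expR (- t) - y0) ^+ 2) ^+ N.+1 * f t) =
    (1 - y0 ^+ 2) * g k t + (2 * y0) * g k.+1 t - g k.+2 t.
  have e1 j : expR (- (j.+1%:R * t)) = expR (- (j%:R * t)) * expR (- t).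
    by rewrite -expRD; congr expR; rewrite -natr1; ring.
  rewrite /g !(e1 k.+1) !(e1 k.+2) !(e1 k.+1) exprS; ring.
rewrite (funext gE).
have [i0 z0] := IH k; have [i1 z1] := IH k.+1; have [i2 z2] := IH k.+2.
have j0 := RintegrableZ (1 - y0 ^+ 2) (measurable_itv `]0, +oo[) i0.
have j1 := RintegrableZ (2 * y0) (measurable_itv `]0, +oo[) i1.
split; first by apply: RintegrableB => //; exact: RintegrableD.
rewrite RintegralB//; last exact: RintegrableD.
rewrite RintegralD// RintegralZl// RintegralZl//.
by rewrite z0 z1 z2 !mulr0 addr0 subr0.
Qed.

(* If f > 0 just to the right of t0, test f against the polynomial
   y (1 - (y - y0)^2)^N in y = e^{-t}, which concentrates at a point y0 of that
   interval as N grows. *)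
Lemma laplace_nonpos (f : R -> R) (M : R) :
  measurable_fun (`]0, +oo[ : set R) f -> (forall t, 0 < t -> `|f t| <= M) ->
  (forall t, 0 < t -> f u @[u --> t^'+] --> f t) ->
  (forall s, 0 < s -> (\int[mu]_(t in `]0%R, +oo[) (expR (- (s * t)) * f t))%R = 0) ->
  forall t, 0 < t -> f t <= 0.
Proof.
move=> mf fM fr f0 t0 t0_gt0; rewrite leNgt; apply/negP => ft0.
pose e := f t0 / 2.
have e0 : 0 < e by rewrite divr_gt0.
have [d d0 fd] : exists2 d, 0 < d & forall u, t0 < u -> u < t0 + d -> e <= f u.
  have /cvgrPdist_lt/(_ e e0) := fr _ t0_gt0.
  rewrite near_withinE => -[d /= d0 H]; exists d => // u tu ud.
  have hb : `|t0 - u| < d by rewrite ltr0_norm ?subr_lt0// opprB; lra.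
  have /ltr_normlP[_ h] := H u hb tu.
  by move: h; rewrite /e; lra.
pose tau := t0 + d / 2; pose y0 := expR (- tau).
(* The distance from [y0] to the ends of the image of ]t0, t0 + d[ under t |-> e^{-t}. *)
pose eta := Num.min (expR (- t0) - y0) (y0 - expR (- (t0 + d))).
have eta0 : 0 < eta.
  by rewrite lt_min !subr_gt0 !ltr_expR !ltrN2 /tau; apply/andP; split; lra.
have eta1 : eta < 1.
  rewrite gt_min; apply/orP; left; rewrite ltrBlDr.
  apply: (@le_lt_trans _ _ 1); first by rewrite expR_le1 oppr_le0 ltW.
  by rewrite ltrDl expR_gt0.
have out t : (t <= t0) || (t0 + d <= t) -> eta <= `|expR (- t) - y0|.
  move=> /orP[tt|tt].
    rewrite (le_trans _ (ler_norm _))// ge_min; apply/orP; left.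
    by rewrite lerB// ler_expR lerN2.
  rewrite distrC (le_trans _ (ler_norm _))// ge_min; apply/orP; right.
  by rewrite lerB// ler_expR lerN2.
have [dl dl0 near_] : exists2 dl, 0 < dl & forall t, tau <= t -> t <= tau + dl ->
    `|expR (- t) - y0| <= eta / 2.
  have c : {for tau, continuous (fun t : R => expR (- t))}.
    by eapply is_derive_continuous; repeat deriv_step.
  have e2 : 0 < eta / 2 by rewrite divr_gt0.
  have /cvgrPdist_le/(_ _ e2) [dl /= dl0 H] := c.
  exists (dl / 2); first by rewrite divr_gt0.
  move=> t t1 t2; rewrite distrC; apply: H => /=.
  by rewrite ler0_norm ?subr_le0// opprB; lra.
have M0 : 0 <= M by apply: le_trans (fM _ t0_gt0); exact: normr_ge0.
pose J : set R := `[tau, tau + dl]%classic.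
have JI t : J t -> t0 < t /\ t < t0 + d.
  rewrite /J/= in_itv/= => /andP[t1 t2]; have := near_ _ t1 t2.
  have [|tt0] := leP t t0; first by move=> h; have := out t; rewrite h /=; lra.
  have [|tt1] := leP (t0 + d) t; last by [].
  by move=> h; have := out t; rewrite h orbT /=; lra.
(* The factor 1 - (y - y0)^2 is at most [a] outside ]t0, t0 + d[ and at least [b] on [J]. Since a <
   b, the N-th power on [J] eventually wins. *)
pose a := 1 - eta ^+ 2; pose b := 1 - (eta / 2) ^+ 2.
have a0 : 0 <= a by rewrite subr_ge0 exprn_ile1// ltW.
have ab : a < b by rewrite /a /b; nra.
have b0 : 0 < b by apply: le_lt_trans ab.
pose A := e * expR (- (tau + dl)).
have A0 : 0 < A by rewrite mulr_gt0// expR_gt0.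
(* The vanishing integral is at least the contribution of [J], where f >= e and e^{-t} >= e^{-(tau +
   dl)}, minus M a^N times the integral 1 of e^{-t}; on the rest of ]t0, t0 + d[ the integrand is
   nonnegative. *)
have key N : A * dl * b ^+ N <= M * a ^+ N.
  have [gi g0] := @laplace_kernel_power f M y0 N 0 mf fM f0.
  rewrite -subr_le0 -g0.
  have mJ : measurable J by exact: measurable_itv.
  have sJ : J `<=` `]0, +oo[%classic.
    by move=> t /JI[tt _]; rewrite /= in_itv/= andbT; exact: lt_trans tt.
  have Ji : mu.-integrable `]0, +oo[ (EFin \o ((fun=> A * b ^+ N) \_ J)).
    rewrite -restrict_EFin; apply/integrable_restrict => //.
    rewrite setIidr//; apply: Rintegrable_itv => t _; exact: cst_continuous.
  have ei : mu.-integrable `]0, +oo[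
      (EFin \o (fun t : R => (M * a ^+ N) * expR (- (1 * t)))).
    by apply: RintegrableZ => //; apply: integrable_expRN.
  have -> : A * dl * b ^+ N - M * a ^+ N = (\int[mu]_(t in `]0%R, +oo[)
     (((fun=> A * b ^+ N) \_ J) t - (M * a ^+ N) * expR (- (1 * t))))%R.
    rewrite RintegralB// RintegralZl ?integrable_expRN// laplace_cst// invr1 mulr1.
    congr (_ - _); rewrite -Rintegral_mkcondr setIidr// Rintegral_cst//.
    have muJ : mu J = dl%:E.
      rewrite /J lebesgue_measure_itv/= lte_fin ltrDl dl0 -EFinD.
      by rewrite addrAC subrr add0r.
    rewrite (_ : fine _ = dl); first by ring.
    by transitivity (fine dl%:E) => //; congr fine; exact: muJ.
  apply: le_Rintegral => //; first exact: RintegrableB.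
  move=> t /=; rewrite in_itv/= andbT => t_gt0; rewrite patchE.
  have y1 : `|expR (- t) - y0| <= 1.
    have : 0 < expR (- t) <= 1 by rewrite expR_gt0 expR_le1 oppr_le0 ltW.
    have : 0 < y0 <= 1 by rewrite expR_gt0 expR_le1 oppr_le0 /tau; lra.
    by move=> /andP[? ?] /andP[? ?]; rewrite ler_norml; apply/andP; split; lra.
  have c0 : 0 <= 1 - (expR (- t) - y0) ^+ 2.
    by rewrite subr_ge0 -real_normK ?num_real// exprn_ile1.
  have E0 := expR_gt0 (- (1 * t)).
  have aN : 0 <= a ^+ N by rewrite exprn_ge0.
  have [tt|tt] := boolP ((t <= t0) || (t0 + d <= t)).
    rewrite ifF; last first.
      apply/negP; rewrite inE => /JI[h1 h2]; move: tt.
      by rewrite !leNgt h1 h2.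
    rewrite sub0r mulrC -mulrN ler_wpM2l ?(ltW E0)//.
    have ca : (1 - (expR (- t) - y0) ^+ 2) ^+ N <= a ^+ N.
      rewrite lerXn2r ?nnegrE// lerB// -[leRHS]real_normK ?num_real//.
      by rewrite lerXn2r ?nnegrE ?(ltW eta0) ?out.
    apply: (@lerNnormlW _ _ (M * a ^+ N)); rewrite mulrC.
    apply: ler_normM; first exact: fM.
    by rewrite ger0_norm ?exprn_ge0.
  move: tt; rewrite negb_or -!ltNge => /andP[tt0 tt1].
  have ft := fd _ tt0 tt1.
  have ft0' : 0 <= f t by apply: le_trans ft; exact: ltW.
  have h0 : 0 <= M * a ^+ N * expR (- (1 * t)) by rewrite !mulr_ge0// ltW.
  case: ifPn => [|_]; last first.
    rewrite sub0r (@le_trans _ _ 0) ?oppr_le0//.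
    by rewrite !mulr_ge0 ?expR_ge0 ?exprn_ge0.
  rewrite inE => Jt; have := Jt; rewrite /J/= in_itv/= => /andP[t1 t2].
  rewrite (@le_trans _ _ (A * b ^+ N)) ?gerBl//.
  rewrite /A (mulrC e) -mulrA; apply: ler_pM.
  - exact: expR_ge0.
  - by rewrite mulr_ge0 ?exprn_ge0 ?(ltW b0) ?(ltW e0).
  - by rewrite ler_expR; lra.
  rewrite (mulrC e); apply: ler_pM; rewrite ?exprn_ge0 ?(ltW b0) ?(ltW e0)//.
  rewrite lerXn2r ?nnegrE ?(ltW b0)// lerB// -[leLHS]real_normK ?num_real//.
  by rewrite lerXn2r ?nnegrE ?near_// divr_ge0// ltW.
have r1 : `|a / b| < 1.
  by rewrite ger0_norm ?divr_ge0 ?(ltW b0)// ltr_pdivrMr// mul1r.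
have cv : M * (a / b) ^+ N @[N --> \oo] --> M * 0.
  by apply: cvgM; [exact: cvg_cst|exact: cvg_expr].
have Ad : 0 < A * dl by rewrite mulr_gt0.
have /cvgrPdist_lt/(_ _ Ad) [N _ /(_ N (leqnn _))] := cv.
rewrite mulr0 sub0r normrN => /(le_lt_trans (ler_norm _)).
rewrite expr_div_n mulrA ltr_pdivrMr ?exprn_gt0//.
by apply/negP; rewrite -leNgt key.
Qed.

(** Right continuity is the regularity of a distribution function; it gives equality at every t > 0
    and not only almost everywhere. *)
Lemma laplace_unique (f g : R -> R) (M : R) :
  measurable_fun (`]0, +oo[ : set R) f -> (forall t, 0 < t -> `|f t| <= M) ->
  measurable_fun (`]0, +oo[ : set R) g -> (forall t, 0 < t -> `|g t| <= M) ->
  (forall t, 0 < t -> f u @[u --> t^'+] --> f t) ->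
  (forall t, 0 < t -> g u @[u --> t^'+] --> g t) ->
  (forall s, 0 < s -> (\int[mu]_(t in `]0%R, +oo[) (expR (- (s * t)) * f t))%R =
    (\int[mu]_(t in `]0%R, +oo[) (expR (- (s * t)) * g t))%R) ->
  forall t, 0 < t -> f t = g t.
Proof.
move=> mf fM mg gM fr gr fg t t0; 
have h (f1 g1 : R -> R) : measurable_fun (`]0, +oo[ : set R) f1 ->
    (forall t, 0 < t -> `|f1 t| <= M) ->
  measurable_fun (`]0, +oo[ : set R) g1 -> (forall t, 0 < t -> `|g1 t| <= M) ->
  (forall t, 0 < t -> f1 u @[u --> t^'+] --> f1 t) ->
  (forall t, 0 < t -> g1 u @[u --> t^'+] --> g1 t) ->
  (forall s, 0 < s -> (\int[mu]_(t in `]0%R, +oo[) (expR (- (s * t)) * f1 t))%R =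
    (\int[mu]_(t in `]0%R, +oo[) (expR (- (s * t)) * g1 t))%R) -> f1 t - g1 t <= 0.
  move=> mf1 fM1 mg1 gM1 fr1 gr1 fg1.
  apply: (@laplace_nonpos (fun t => f1 t - g1 t) (M + M)) => //.
  - exact: measurable_funB.
  - by move=> u u0; apply: ler_normBD; [exact: fM1|exact: gM1].
  - by move=> u u0; apply: cvgB; [exact: fr1|exact: gr1].
  - move=> s s0; under eq_Rintegral do rewrite mulrBr.
    rewrite RintegralB ?fg1 ?subrr//.
    + exact: integrable_expRN_mul fM1.
    + exact: integrable_expRN_mul gM1.
apply/eqP; rewrite eq_le; apply/andP; split; rewrite -subr_le0; apply: h => //.
by move=> s s0; rewrite fg.
Qed.

End laplace_uniqueness.

(** * Fubini's theorem on the open quadrant *)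

Section quadrant_fubini.
Context {R : realType}.
Local Notation mu := (@lebesgue_measure R).
Local Notation D := (`]0%R, +oo[%classic : set R).

Lemma integrable_prod_mul (g h : R -> R) :
  mu.-integrable setT (EFin \o g) -> mu.-integrable setT (EFin \o h) ->
  (mu \x mu)%E.-integrable setT (fun z : R * R => (g z.1 * h z.2)%:E).
Proof.
move=> gi hi.
have mg : measurable_fun setT g by have /integrableP[/measurable_EFinP] := gi.
have mh : measurable_fun setT h by have /integrableP[/measurable_EFinP] := hi.
have mF : measurable_fun setT (fun z : R * R => (g z.1 * h z.2)%:E).
  apply/measurable_EFinP; apply: measurable_funM.
    exact: measurableT_comp.
  exact: measurableT_comp.
apply/integrable12ltyP => //.
have hE x : (\int[mu]_y `|(g x * h y)%:E| = `|g x|%:E * \int[mu]_y `|(h y)%:E|)%E.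
  rewrite -ge0_integralZl//; first by apply: eq_integral => y _; rewrite EFinM abseM.
  by apply: measurableT_comp => //; exact/measurable_EFinP.
have hfin : (\int[mu]_y `|(h y)%:E|)%E \is a fin_num.
  rewrite ge0_fin_numE ?integral_ge0//.
  by have /integrableP[] := hi.
under eq_integral do rewrite /= hE.
rewrite ge0_integralZr//.
- have gfin : (\int[mu]_x `|g x|%:E < +oo)%E by have /integrableP[] := gi.
  apply: lte_mul_pinfty; [exact: integral_ge0| |].
    by rewrite ge0_fin_numE ?integral_ge0.
  by have /integrableP[] := hi.
- by apply/measurable_EFinP; exact: measurableT_comp.
- exact: integral_ge0.
Qed.

Lemma Rintegral_restrict (f : R -> R) : mu.-integrable D (EFin \o f) ->
  mu.-integrable setT (EFin \o (f \_ D)) /\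
  (\int[mu]_t (f \_ D) t)%R = (\int[mu]_(t in D) f t)%R.
Proof.
move=> fi; split; last by rewrite -Rintegral_mkcond.
by rewrite -restrict_EFin; apply/integrable_restrict => //=; rewrite setTI.
Qed.

(** The majorant is a product because the ray estimates have that shape: e^{-(s+l) t} in time and C
    (1 + r)^-2 in the radius. *)
Lemma Rintegral_Fubini (f : R -> R -> R) (g h : R -> R) :
  measurable_fun setT (fun z : R * R => f z.1 z.2) ->
  mu.-integrable D (EFin \o g) -> mu.-integrable D (EFin \o h) ->
  (forall t r, 0 < t -> 0 < r -> `|f t r| <= g t * h r) ->
  (\int[mu]_(t in D) \int[mu]_(r in D) f t r)%R =
  (\int[mu]_(r in D) \int[mu]_(t in D) f t r)%R.
Proof.
move=> mf gi hi fgh.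
pose F (z : R * R) := ((fun z : R * R => f z.1 z.2) \_ (D `*` D)) z.
have mD : measurable (D `*` D) by exact: measurableX.
have mF : measurable_fun setT F.
  by apply/(measurable_restrictT _ mD); exact: measurable_funTS.
have FE t r : F (t, r) = ((fun t => (f t \_ D) r) \_ D) t.
  rewrite /F !patchE; case: ifPn => [|].
    by rewrite in_setX/= => /andP[-> ->].
  rewrite in_setX/= negb_and => /orP[/negbTE ->//|/negbTE h0].
  by rewrite h0; case: ifP.
have FE' t r : F (t, r) = ((fun r => ((f^~ r) \_ D) t) \_ D) r.
  by rewrite FE !patchE; case: ifP; case: ifP.
have [gi' _] := Rintegral_restrict gi.
have [hi' _] := Rintegral_restrict hi.
have Fi : (mu \x mu)%E.-integrable setT (EFin \o F).
  apply: (le_integrable _ _ _ (integrable_prod_mul gi' hi')) => //.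
    exact/measurable_EFinP.
  move=> [t r] _; rewrite /= lee_fin FE !patchE.
  case: ifPn => [|_]; last by rewrite normr0 mul0r normr0.
  case: ifPn => [|_]; last by rewrite normr0 mulr0 normr0.
  rewrite !inE/= !in_itv/= !andbT => r0 t0.
  by apply: le_trans (fgh _ _ t0 r0) (ler_norm _).
have := Fubini Fi; rewrite /=.
have -> : (fun t => \int[mu]_r (F (t, r))%:E)%E =
    (fun t => (((fun t => \int[mu]_(r in D) f t r)%R \_ D) t)%:E).
  apply/funext => t.
  have [t0|t0] := boolP (t \in D); last first.
    under eq_integral do rewrite FE patchE (negbTE t0).
    by rewrite integral0 patchE (negbTE t0).
  rewrite patchE t0.
  under eq_integral do rewrite FE patchE t0.
  have fti : mu.-integrable D (EFin \o f t).
    move: t0; rewrite inE/= in_itv/= andbT => t0.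
    apply: (Rintegrable_le (g := fun r => g t * h r)) => //.
    - apply: measurable_funTS.
      exact: (measurableT_comp mf (measurable_pair1 t)).
    - exact: RintegrableZ.
    - by move=> r /=; rewrite in_itv/= andbT => r0; exact: fgh.
  have [fi <-] := Rintegral_restrict fti.
  by rewrite /Rintegral fineK//; exact: integrable_fin_num.
have -> : (fun r => \int[mu]_t (F (t, r))%:E)%E =
    (fun r => (((fun r => \int[mu]_(t in D) f t r)%R \_ D) r)%:E).
  apply/funext => r.
  have [r0|r0] := boolP (r \in D); last first.
    under eq_integral do rewrite FE' patchE (negbTE r0).
    by rewrite integral0 patchE (negbTE r0).
  rewrite patchE r0.
  under eq_integral do rewrite FE' patchE r0.
  have fti : mu.-integrable D (EFin \o f^~ r).
    move: r0; rewrite inE/= in_itv/= andbT => r0.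
    apply: (Rintegrable_le (g := fun t => h r * g t)) => //.
    - apply: measurable_funTS.
      exact: (measurableT_comp mf (measurable_pair2 r)).
    - exact: RintegrableZ.
    - by move=> t /=; rewrite in_itv/= andbT => t0; rewrite mulrC; exact: fgh.
  have [fi <-] := Rintegral_restrict fti.
  by rewrite /Rintegral fineK//; exact: integrable_fin_num.
move=> H; rewrite [LHS]Rintegral_mkcond [RHS]Rintegral_mkcond.
by rewrite /Rintegral H.
Qed.

End quadrant_fubini.

(* The candidate for P(D(x) <= t); independent of th in ]pi/2, pi] for t > 0. *)
Definition ray_tail {R : realType} (b x l th t : R) : R :=
  1 + expR (l `^ b * x - l * t) / pi *
      (\int[@lebesgue_measure R]_(r in `]0%R, +oo[) ray_im b x t l r th)%R.

(** * The Laplace transform of the candidate *)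

Section ray_tail.
Context {R : realType}.
Local Notation mu := (@lebesgue_measure R).
Local Notation D := (`]0%R, +oo[%classic : set R).
Variables (b x l th0 : R).
Hypotheses (b0 : 0 < b) (b1 : b < 1) (x0 : 0 < x) (l0 : 0 < l).
Hypotheses (th0_pihalf : pi / 2 < th0) (th0_pi : th0 < pi).
Hypothesis (bth0 : b * th0 < pi / 2).

Local Notation im := (fun t r => ray_im b x t l r th0).

Let th0_gt0 : 0 < th0.
Proof. by apply: lt_trans th0_pihalf; rewrite divr_gt0 ?pi_gt0. Qed.

Let cos_th0 : cos th0 <= 0.
Proof.
have p0 := pi_gt0 R; have h := th0_pihalf; have h' := th0_pi.
by rewrite -cos_pihalf; apply: ler_cos_pi; lra.
Qed.

(** On this ray e^{t r cos th0} <= 1, and b th0 < pi / 2 makes e^{-x z^b} decay by itself, so one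
    majorant serves all t >= 0. *)
Lemma ray_im_uniform_bound : exists2 C : R, 0 <= C & forall t r, 0 <= t -> 0 < r ->
  `|im t r| <= C * ((1 + r) ^+ 2)^-1.
Proof.
have [C C0 HC] := ray_exp0_decay b0 x0 th0_gt0 bth0.
exists ((1 + l) * C / l ^+ 2).
  by rewrite divr_ge0 ?mulr_ge0 ?addr_ge0 ?exprn_ge0 ?(ltW l0) ?(ltW C0).
move=> t r t0 r0; apply: ray_im_decay => //; first by rewrite exprn_gt0.
  exact: (ray_den_left l0 th0_pihalf (ltW r0) (lexx _) (ltW th0_pi)).
apply: le_trans (HC r th0 r0 (ltW th0_gt0) (lexx _)).
rewrite ler_wpM2r ?exprn_ge0 ?addr_ge0 ?(ltW r0)// ler_expR /ray_exp !mul0r.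
rewrite lerD2r.
by rewrite mulr_ge0_le0 ?mulr_ge0 ?(ltW r0).
Qed.

Lemma ray_im_continuous_time t r : 0 < r -> {for t, continuous (fun t => im t r)}.
Proof.
move=> r0; eapply is_derive_continuous; rewrite /ray_im /ray_exp /ray_arg.
by repeat deriv_step.
Qed.

Lemma ray_im_integrable_time t : 0 <= t -> mu.-integrable D (EFin \o im t).
Proof.
move=> t0; have [C C0 HC] := ray_im_uniform_bound.
apply: (Rintegrable_le (g := fun r => C * ((1 + r) ^+ 2)^-1)) => //.
- apply: continuous_measurable_itv => r; rewrite in_itv/= andbT => r0.
  by apply: ray_im_continuous => //; apply: cos_lt1 => //; exact: ltW.
- by apply: RintegrableZ => //; exact: integrable_inv_sqr.
- by move=> r /=; rewrite in_itv/= andbT => r0; exact: HC.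
Qed.

Lemma ray_integral_continuous t : 0 < t ->
  {for t, continuous (fun t => \int[mu]_(r in D) im t r)%R}.
Proof.
move=> t0; have [C C0 HC] := ray_im_uniform_bound.
have := @continuity_under_integral R _ _ mu im D (measurable_itv _) 0 (t + 1).
apply.
- move=> u; rewrite /= in_itv/= => /andP[u0 _].
  exact: ray_im_integrable_time (ltW u0).
- apply: aeW => r /=; rewrite in_itv/= andbT => r0 u _.
  exact: ray_im_continuous_time.
- apply: (RintegrableZ C _ integrable_inv_sqr); exact: measurable_itv.
- move=> u; rewrite /= in_itv/= => /andP[u0 _]; apply: aeW => r /=.
  by rewrite in_itv/= andbT => r0; apply: HC => //; exact: ltW.
- by rewrite inE/= in_itv/= t0 ltrDl ltr01.
Qed.

Lemma ray_tail_continuous t : 0 < t -> {for t, continuous (ray_tail b x l th0)}.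
Proof.
move=> t0; apply: cvgD; first exact: cvg_cst.
apply: cvgM; last exact: ray_integral_continuous.
suff : {for t, continuous (fun t => expR (l `^ b * x - l * t) / pi)} by [].
by eapply is_derive_continuous; repeat deriv_step.
Qed.

Lemma ray_integral_bounded : exists2 M, 0 <= M & forall t, 0 <= t ->
  `|(\int[mu]_(r in D) im t r)%R| <= M.
Proof.
have [C C0 HC] := ray_im_uniform_bound.
exists (\int[mu]_(r in D) (C * ((1 + r) ^+ 2)^-1))%R.
  by apply: Rintegral_ge0 => r _; rewrite mulr_ge0 ?invr_ge0 ?sqr_ge0.
move=> t t0; have ii := ray_im_integrable_time t0.
apply: le_trans (le_normr_Rintegral _ ii) _ => //.
apply: le_Rintegral => //.
- exact: integrable_norm.
- by apply: RintegrableZ => //; exact: integrable_inv_sqr.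
- by move=> r /=; rewrite in_itv/= andbT => r0; exact: HC.
Qed.

Lemma ray_tail_bounded : exists M, forall t, 0 < t -> `|ray_tail b x l th0 t| <= M.
Proof.
have [M M0 HM] := ray_integral_bounded; have p0 := pi_gt0 R.
exists (1 + expR (l `^ b * x) / pi * M) => t t0; apply: ler_normDD.
  by rewrite normr1.
apply: ler_normM; last exact: HM (ltW t0).
rewrite ger0_norm ?divr_ge0 ?expR_ge0 ?(ltW p0)//.
rewrite ler_wpM2r ?invr_ge0 ?(ltW p0)// ler_expR gerBl.
by rewrite mulr_ge0 ?ltW.
Qed.

Lemma ray_im_measurable :
  measurable_fun setT (fun z : R * R => im z.1 z.2).
Proof.
have mcst (c : R) : measurable_fun setT (fun _ : R * R => c) by [].
have m1 : measurable_fun setT (fun z : R * R => z.1) by exact: measurable_fst.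
have m2 : measurable_fun setT (fun z : R * R => z.2) by exact: measurable_snd.
have mp : measurable_fun setT (fun z : R * R => z.2 `^ b).
  exact: (measurableT_comp (measurable_powR b) m2).
have me : measurable_fun setT (fun z : R * R => ray_exp b x z.1 z.2 th0).
  by apply: measurable_funB; do 2 (apply: measurable_funM => //).
have ma : measurable_fun setT (fun z : R * R => ray_arg b x z.1 z.2 th0).
  by apply: measurable_funB; do 2 (apply: measurable_funM => //).
have md : measurable_fun setT (fun z : R * R => ray_den l z.2 th0).
  apply: measurable_funD => //; apply: measurable_funB.
    by under eq_fun do rewrite expr2; exact: measurable_funM.
  by do 2 (apply: measurable_funM => //).
have -> : (fun z : R * R => im z.1 z.2) = (fun z : R * R =>
  expR (ray_exp b x z.1 z.2 th0) *
  (z.2 * sin (ray_arg b x z.1 z.2 th0) - l * sin (ray_arg b x z.1 z.2 th0 + th0)) *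
  (ray_den l z.2 th0) `^ (-1)).
  (* the library has measurability of powers, not of inverses *)
  apply/funext => z; rewrite powR_inv1// ray_denE.
  by rewrite addr_ge0 ?sqr_ge0.
have msin : measurable_fun setT (@sin R).
  by apply: continuous_measurable_fun; exact: continuous_sin.
apply: measurable_funM; last exact: (measurableT_comp (measurable_powR _) md).
apply: measurable_funM; first exact: (measurableT_comp (@measurable_expR R) me).
apply: measurable_funB; apply: measurable_funM => //.
  exact: (measurableT_comp msin ma).
by apply: (measurableT_comp msin); exact: measurable_funD.
Qed.

(** Integrating e^{-(s+l) t} e^{t z} over t gives 1 / (s + l - z), and 1 / ((z - l) (s + l - z)) =
    (1/(z - l) - 1/(z - (s + l))) / s: two Cauchy integrals at t = 0, with poles l and s + l. *)
Lemma laplace_ray_integral s : 0 < s ->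
  (\int[mu]_(t in D) (expR (- ((s + l) * t)) * \int[mu]_(r in D) im t r))%R =
  pi / s * (expR (- (x * (s + l) `^ b)) - expR (- (x * l `^ b))).
Proof.
move=> s0; have p0 := pi_gt0 R; have hl := l0; have hct := cos_th0.
have [C C0 HC] := ray_im_uniform_bound.
have q0 : 0 < s + l by rewrite addr_gt0.
pose f t r := expR (- ((s + l) * t)) * im t r.
transitivity (\int[mu]_(t in D) \int[mu]_(r in D) f t r)%R.
  apply: eq_Rintegral => t; rewrite inE/= in_itv/= andbT => t0.
  by rewrite RintegralZl//; exact: ray_im_integrable_time (ltW t0).
rewrite (@Rintegral_Fubini _ _ (fun t => expR (- ((s + l) * t)))
  (fun r => C * ((1 + r) ^+ 2)^-1)); first last.
- move=> t r t0 r0; apply: ler_normM; first by rewrite ger0_norm ?expR_ge0.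
  by apply: HC => //; exact: ltW.
- by apply: RintegrableZ => //; exact: integrable_inv_sqr.
- exact: integrable_expRN.
- apply: measurable_funM; last exact: ray_im_measurable.
  apply: (measurableT_comp (@measurable_expR R)).
  have -> : (fun z : R * R => - ((s + l) * z.1)) = (fun z : R * R => (- (s + l)) * z.1).
    by apply/funext => z; rewrite mulNr.
  by apply: measurable_funM => //; exact: measurable_fst.
transitivity (\int[mu]_(r in D)
   (s^-1 * (ray_im b x 0 l r th0 - ray_im b x 0 (s + l) r th0)))%R.
  apply: eq_Rintegral => r; rewrite inE/= in_itv/= andbT => r0.
  (* Here s + l - z = a - i c, and e^{-x z^b} = W e^{- i om}. *)
  pose a := s + l - r * cos th0; pose c := r * sin th0.
  pose om := x * r `^ b * sin (b * th0).
  pose W := expR (- (x * r `^ b * cos (b * th0))).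
  have c1 : cos th0 < 1 by apply: cos_lt1 => //; exact: ltW.
  have dl : 0 < ray_den l r th0 by exact: ray_den_gt0.
  have dq : 0 < ray_den (s + l) r th0 by exact: ray_den_gt0.
  have a0 : 0 < a by rewrite /a; nra.
  have intS phi : mu.-integrable D
     (EFin \o (fun t => expR (- (a * t)) * sin (c * t + phi))).
    apply: (@integrable_expRN_mul _ _ 1) => //; last by move=> t _; exact: sin_max.
    apply: continuous_measurable_itv => u _.
    by eapply is_derive_continuous; repeat deriv_step.
  transitivity (\int[mu]_(t in D) (W / ray_den l r th0 *
     (r * (expR (- (a * t)) * sin (c * t + - om)) -
      l * (expR (- (a * t)) * sin (c * t + (th0 - om))))))%R.
    apply: eq_Rintegral => t _; rewrite /f /ray_im /ray_exp /ray_arg.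
    have -> : expR (t * r * cos th0 - x * r `^ b * cos (b * th0)) =
              expR (t * r * cos th0) * W by rewrite -expRD.
    have -> : expR (- (a * t)) = expR (- ((s + l) * t)) * expR (t * r * cos th0).
      by rewrite -expRD /a; congr expR; ring.
    have -> : t * r * sin th0 - x * r `^ b * sin (b * th0) = c * t + - om.
      by rewrite /c /om; ring.
    have -> : c * t + - om + th0 = c * t + (th0 - om) by ring.
    by ring.
  rewrite RintegralZl//; last by apply: RintegrableB => //; apply: RintegrableZ.
  rewrite RintegralB//; [|exact: RintegrableZ|exact: RintegrableZ].
  rewrite !RintegralZl// !laplace_sin//.
  have -> : a ^+ 2 + c ^+ 2 = ray_den (s + l) r th0.
    by rewrite /a /c ray_denE !exprMn !sin2cos2; ring.
  rewrite /ray_im /ray_exp /ray_arg !mul0r !sub0r -/om -/W (addrC (- om) th0).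
  rewrite !(sinD th0) !(cosD th0) sinN cosN /a /c.
  move: dl dq; rewrite /ray_den.
  have := cos2Dsin2 th0.
  move: (cos th0) (sin th0) (cos om) (sin om) => Ct St Co So CS dl dq.
  have St2 : St ^+ 2 = 1 - Ct ^+ 2 by rewrite -CS; ring.
  (* The partial fraction identity holds up to a multiple of 1 - Ct^2 - St^2, which is displayed and
     then removed. *)
  transitivity (s^-1 *
    (W * (r * - So - l * (St * Co + Ct * - So)) /
      (r ^+ 2 - 2 * l * r * Ct + l ^+ 2) -
     W * (r * - So - (s + l) * (St * Co + Ct * - So)) /
       (r ^+ 2 - 2 * (s + l) * r * Ct + (s + l) ^+ 2)) +
    W * l * r * So * (1 - Ct ^+ 2 - St ^+ 2) / (r ^+ 2 - 2 * l * r * Ct + l ^+ 2) /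
     (r ^+ 2 - 2 * (s + l) * r * Ct + (s + l) ^+ 2)).
    by field; rewrite !gt_eqF.
  by rewrite St2 subrr mulr0 !mul0r addr0.
have i1 := stieltjes_integrable b0 x0 l0 th0_gt0 th0_pi bth0.
have i2 := stieltjes_integrable b0 x0 q0 th0_gt0 th0_pi bth0.
rewrite RintegralZl//; last exact: RintegrableB.
rewrite RintegralB//.
by rewrite !(stieltjes b0 b1 x0 _ th0_gt0 th0_pi bth0)//; ring.
Qed.

(** The summand 1 of [ray_tail] contributes 1/s and cancels the term coming from - e^{-x l^b}. *)
Lemma laplace_ray_tail s : 0 < s ->
  (\int[mu]_(t in D) (expR (- (s * t)) * ray_tail b x l th0 t))%R =
  s^-1 * expR (- (x * ((s + l) `^ b - l `^ b))).
Proof.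
move=> s0; have p0 := pi_gt0 R.
have q0 : 0 < s + l by rewrite addr_gt0.
have [M M0 HM] := ray_integral_bounded.
have i2 : mu.-integrable D (EFin \o (fun t =>
    expR (- ((s + l) * t)) * \int[mu]_(r in D) im t r)%R).
  apply: (@integrable_expRN_mul _ _ M) => //.
    apply: continuous_measurable_itv => t; rewrite in_itv/= andbT.
    exact: ray_integral_continuous.
  by move=> t /ltW; exact: HM.
transitivity (\int[mu]_(t in D) (expR (- (s * t)) + expR (l `^ b * x) / pi *
   (expR (- ((s + l) * t)) * \int[mu]_(r in D) im t r)))%R.
  apply: eq_Rintegral => t _; rewrite /ray_tail mulrDr mulr1; congr (_ + _).
  rewrite !mulrA; congr (_ * _).
  have -> : expR (l `^ b * x - l * t) = expR (l `^ b * x) * expR (- (l * t)).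
    by rewrite -expRD.
  have -> : expR (- ((s + l) * t)) = expR (- (s * t)) * expR (- (l * t)).
    by rewrite -expRD; congr expR; ring.
  by ring.
rewrite RintegralD//; [|exact: integrable_expRN|exact: RintegrableZ].
rewrite RintegralZl// laplace_cst// laplace_ray_integral//.
have -> : expR (- (x * ((s + l) `^ b - l `^ b))) =
  expR (l `^ b * x) * expR (- (x * (s + l) `^ b)) by rewrite -expRD; congr expR; ring.
rewrite (mulrC (l `^ b)) (expRN (x * l `^ b)).
have := expR_gt0 (x * l `^ b); set E := expR (x * _) => E0.
by move: (pi : R) p0 => p p0; field; rewrite !gt_eqF.
Qed.

End ray_tail.

(** * The density of the inverse subordinator *)

Definition its_integrand {R : realType} (b l t x y : R) : R :=
  expR (- t * y - x * y `^ b * cos (b * pi)) / (y + l) *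
  (l `^ b * sin (x * y `^ b * sin (b * pi)) +
   y `^ b * sin (b * pi - x * y `^ b * sin (b * pi))).

Definition its_density {R : realType} (b l t x : R) : R :=
  1 / pi * expR (l `^ b * x - l * t) *
  (\int[@lebesgue_measure R]_(y in `]0%R, +oo[) its_integrand b l t x y)%R.

Section its_density.
Context {R : realType}.
Local Notation mu := (@lebesgue_measure R).
Local Notation D := (`]0%R, +oo[%classic : set R).
Variables (b l t : R).
Hypotheses (b0 : 0 < b) (b1 : b < 1) (l0 : 0 < l) (t0 : 0 < t).

(** For y > 0 this is [- ray_im b x t l y pi]; [dkern] is its x-derivative, by the subtraction
    formula for the sine. *)
Let kern x y := expR (- t * y - x * y `^ b * cos (b * pi)) / (y + l) *
  sin (x * y `^ b * sin (b * pi)).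
Let dkern x y := expR (- t * y - x * y `^ b * cos (b * pi)) / (y + l) *
  (y `^ b * sin (b * pi - x * y `^ b * sin (b * pi))).

(** Uniformity in x < x2 is what differentiation in x needs. As [cos (b * pi)] may be negative, x
    y^b is beaten only by e^{-t y}. The factor [A] stands for a sine, possibly times y^b, which is
    at most 1 + y. *)
Let kern_bound (x2 : R) : 0 < x2 -> exists2 C : R, 0 <= C &
  forall x y (A B : R), 0 < x -> x < x2 -> 0 < y ->
  `|A| <= B * (1 + y) ->
  `|expR (- t * y - x * y `^ b * cos (b * pi)) / (y + l) * A| <=
    B * (C * ((1 + y) ^+ 2)^-1).
Proof.
move=> x20; have [C C0 HC] := expR_lin_powR_decay b0 b1 t0 (ltW x20).
exists (C / l); first by rewrite divr_ge0 ?ltW.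
move=> x y A B x0 xx2 y0 AB.
have y1 : 0 < 1 + y by rewrite addr_gt0.
have B0 : 0 <= B by have := le_trans (normr_ge0 _) AB; rewrite pmulr_lge0.
have eC : expR (- t * y - x * y `^ b * cos (b * pi)) <= C * ((1 + y) ^+ 4)^-1.
  rewrite ler_pdivlMr ?exprn_gt0//; apply: le_trans (HC _ y0).
  rewrite ler_wpM2r ?exprn_ge0 ?(ltW y1)// ler_expR mulNr lerD2l -mulrN.
  apply: (@le_trans _ _ (x * y `^ b * 1)).
    by rewrite ler_wpM2l ?mulr_ge0 ?powR_ge0 ?(ltW x0)// lerNl cos_geN1.
  by rewrite mulr1 ler_wpM2r ?powR_ge0 ?(ltW xx2).
apply: (@le_trans _ _ (C * ((1 + y) ^+ 4)^-1 / l * (B * (1 + y)))).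
  apply: ler_normM => //; apply: ler_normM; first by rewrite ger0_norm ?expR_ge0.
  rewrite ger0_norm ?invr_ge0 ?addr_ge0 ?(ltW y0) ?(ltW l0)//.
  by rewrite lef_pV2 ?posrE ?addr_gt0// lerDr ltW.
have -> : C / ((1 + y) ^+ 4) / l * (B * (1 + y)) =
    B * (C / l * (((1 + y) ^+ 2)^-1 * (1 + y)^-1)) by field; rewrite !gt_eqF.
rewrite ler_wpM2l// mulrA ler_piMr ?mulr_ge0 ?invr_ge0 ?exprn_ge0 ?ltW//.
by rewrite invf_lt1// ltrDl.
Qed.

Let powR_le y : 0 < y -> `|y `^ b| <= 1 + y.
Proof.
move=> y0; rewrite ger0_norm ?powR_ge0//.
have h1 : 1 <= 1 + y by rewrite lerDl ltW.
apply: le_trans (ler1_powR h1 (ltW b1)).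
by rewrite ge0_ler_powR ?nnegrE ?addr_ge0 ?(ltW b0) ?(ltW y0)// lerDr.
Qed.

Let measurable_D (f : R -> R) :
  (forall y, 0 < y -> {for y, continuous f}) -> measurable_fun D f.
Proof.
move=> cf; apply: continuous_measurable_itv => y.
by rewrite in_itv/= andbT; exact: cf.
Qed.

Let cont_kern x y : 0 < y -> {for y, continuous (kern x)}.
Proof.
move=> y0; have yl : y + l != 0 by rewrite gt_eqF// addr_gt0.
by eapply is_derive_continuous; rewrite /kern; repeat deriv_step; do ?exact: y0.
Qed.

Let cont_dkern x y : 0 < y -> {for y, continuous (dkern x)}.
Proof.
move=> y0; have yl : y + l != 0 by rewrite gt_eqF// addr_gt0.
by eapply is_derive_continuous; rewrite /dkern; repeat deriv_step; do ?exact: y0.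
Qed.

Let kern_le x2 : 0 < x2 -> exists2 C, 0 <= C & forall x y, 0 < x -> x < x2 ->
  0 < y -> `|kern x y| <= C * ((1 + y) ^+ 2)^-1 /\
           `|dkern x y| <= C * ((1 + y) ^+ 2)^-1.
Proof.
move=> x20; have [C C0 HC] := kern_bound x20; exists C => // x y x0 xx2 y0.
rewrite -(mul1r (C * _)) /kern /dkern; split; apply: HC => //; rewrite mul1r.
  by rewrite (le_trans (sin_max _))// lerDl ltW.
by rewrite -[leRHS]mulr1; apply: ler_normM; [exact: powR_le|exact: sin_max].
Qed.

Let integrable_kern x : 0 < x -> mu.-integrable D (EFin \o kern x) /\
  mu.-integrable D (EFin \o dkern x).
Proof.
move=> x0; have x1 : x < x + 1 by rewrite ltrDl.
have [C C0 HC] := kern_le (lt_trans x0 x1).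
have Ci := RintegrableZ C (measurable_itv `]0, +oo[) (@integrable_inv_sqr R).
split; apply: (Rintegrable_le _ _ Ci) => //.
- by apply: measurable_D => y; exact: cont_kern.
- by move=> y /=; rewrite in_itv/= andbT => y0; have [] := HC _ _ x0 x1 y0.
- by apply: measurable_D => y; exact: cont_dkern.
- by move=> y /=; rewrite in_itv/= andbT => y0; have [] := HC _ _ x0 x1 y0.
Qed.

Let its_integrandE x y : its_integrand b l t x y = l `^ b * kern x y + dkern x y.
Proof. by rewrite /its_integrand /kern /dkern; ring. Qed.

Lemma its_integrand_integrable x : 0 < x ->
  mu.-integrable D (EFin \o its_integrand b l t x).
Proof.
move=> /integrable_kern[i1 i2]; rewrite (funext (its_integrandE x)).
by apply: RintegrableD => //; exact: RintegrableZ.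
Qed.

Let is_derive_kern (x : R) : 0 < x ->
  is_derive x 1 (fun x => \int[mu]_(y in D) kern x y)%R
    (\int[mu]_(y in D) dkern x y)%R.
Proof.
move=> x0; have x1 : 0 < x + 1 by rewrite addr_gt0.
have [C C0 HC] := kern_le x1.
apply: (@is_derive_Rintegral R kern dkern D x 0 (x + 1)
  (fun y => C * ((1 + y) ^+ 2)^-1)).
- exact: measurable_itv.
- by rewrite in_itv/= x0 ltrDl ltr01.
- by move=> u; rewrite in_itv/= => /andP[u0 _]; have [] := integrable_kern u0.
- move=> u y _; rewrite /= in_itv/= andbT => y0.
  have yl : y + l != 0 by rewrite gt_eqF// addr_gt0.
  by rewrite /kern; deriv; rewrite /dkern sinB /=; field.
- by apply: RintegrableZ => //; exact: integrable_inv_sqr.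
- move=> u y; rewrite in_itv/= => /andP[u0 ux]; rewrite /= in_itv/= andbT => y0.
  by have [] := HC _ _ u0 ux y0.
Qed.

(** The product rule produces the bracket of the formula: [l]^ b[times the sine from the factor
    e^{l^b x}, and the term with]y [^ b] from the kernel. *)
Lemma is_derive_ray_tail_pi (x : R) : 0 < x ->
  is_derive x 1 (fun x => ray_tail b x l pi t) (- its_density b l t x).
Proof.
move=> x0; have [i1 i2] := integrable_kern x0.
have tailE u : 0 < u -> ray_tail b u l pi t =
    1 - expR (l `^ b * u - l * t) / pi * (\int[mu]_(y in D) kern u y)%R.
  move=> u0; have [iu _] := integrable_kern u0; rewrite /ray_tail.
  have -> : (\int[mu]_(r in D) ray_im b u t l r pi)%R =
      (\int[mu]_(r in D) (-1 * kern u r))%R.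
    apply: eq_Rintegral => r; rewrite inE/= in_itv/= andbT => r0.
    by rewrite ray_im_pi// /kern mulN1r mulNr mulrAC.
  by rewrite RintegralZl//; ring.
have dT : is_derive x 1 (fun u : R =>
    1 - expR (l `^ b * u - l * t) / pi * (\int[mu]_(y in D) kern u y)%R)
    (- its_density b l t x).
  have dk := is_derive_kern x0.
  notypeclasses refine (deriv_eq _ _).
    notypeclasses refine (deriv_sub _ _); first exact: deriv_cst.
    notypeclasses refine (deriv_mul _ _); last exact: dk.
    by repeat deriv_step.
  rewrite /= /its_density (funext (its_integrandE x)).
  rewrite RintegralD//; last exact: RintegrableZ.
  by rewrite RintegralZl//; ring.
have nE : {near x, (fun u : R =>
    1 - expR (l `^ b * u - l * t) / pi * (\int[mu]_(y in D) kern u y)%R) =1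
  (fun u => ray_tail b u l pi t)}.
  near=> u; rewrite tailE//; near: u; exact: lt_nbhsr.
exact: (near_eq_is_derive nE dT).
Unshelve. all: by end_near. Qed.

Lemma its_density_continuous (x : R) : 0 < x ->
  {for x, continuous (its_density b l t)}.
Proof.
move=> x0; apply: cvgM.
  suff : {for x, continuous (fun x => 1 / pi * expR (l `^ b * x - l * t))} by [].
  by eapply is_derive_continuous; repeat deriv_step.
have x1 : 0 < x + 1 by rewrite addr_gt0.
have [C C0 HC] := kern_le x1.
have := @continuity_under_integral R _ _ mu (its_integrand b l t) D
  (measurable_itv _) 0 (x + 1).
apply.
- by move=> u; rewrite /= in_itv/= => /andP[u0 _]; exact: its_integrand_integrable.
- apply: aeW => y /=; rewrite in_itv/= andbT => y0 u _.
  by eapply is_derive_continuous; rewrite /its_integrand; repeat deriv_step.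
- apply: (RintegrableZ (l `^ b * C + C) _ (@integrable_inv_sqr R)).
  exact: measurable_itv.
- move=> u; rewrite /= in_itv/= => /andP[u0 ux]; apply: aeW => y /=.
  rewrite in_itv/= andbT => y0; have [h1 h2] := HC _ _ u0 ux y0.
  rewrite its_integrandE mulrDl; apply: ler_normDD => //.
  by rewrite -mulrA; apply: ler_normM => //; rewrite ger0_norm ?powR_ge0.
- by rewrite inE/= in_itv/= x0 ltrDl ltr01.
Qed.

End its_density.

(** * Densities: recovery from tails, and uniqueness of the continuous version *)

Section density_measure.
Context {R : realType}.
Local Notation mu := (@lebesgue_measure R).
Variable f : R -> R.
Hypotheses (mf : measurable_fun setT f) (f0 : forall x, 0 <= f x).

(* The two proofs are arguments only so that the measure instance can be
   inferred. *)
Definition density_measure of measurable_fun setT f & (forall x, 0 <= f x) :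
  set R -> \bar R := fun A => (\int[mu]_(x in A) (f x)%:E)%E.

Local Notation nu := (density_measure mf f0).

Let density_measure0 : nu set0 = 0%E.
Proof. by rewrite /density_measure integral_set0. Qed.

Let density_measure_ge0 A : (0 <= nu A)%E.
Proof. by apply: integral_ge0 => x _; rewrite lee_fin. Qed.

Let density_measure_sigma_additive : semi_sigma_additive nu.
Proof.
move=> /= F mF tF mUF; rewrite /density_measure; apply: cvg_toP.
  apply: ereal_nondecreasing_is_cvgn => m n mn.
  apply: lee_sum_nneg_natr => // k _ _; exact: density_measure_ge0.
rewrite ge0_integral_bigcup//=.
- by apply/measurable_funTS/measurableT_comp.
- by move=> x _; rewrite lee_fin.
Qed.

HB.instance Definition _ := isMeasure.Build _ _ _
  nu density_measure0 density_measure_ge0 density_measure_sigma_additive.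

End density_measure.

Section density_of_tails.
Context {R : realType}.
Local Notation mu := (@lebesgue_measure R).

(** The half-lines ]x, +oo[ are a generating class stable under intersection; as neither measure
    charges ]-oo, 0], the case x > 0 determines the others. *)
Lemma measure_eq_density (m : {measure set R -> \bar R}) (f : R -> R) :
  measurable_fun setT f -> (forall x, 0 <= f x) -> (m setT < +oo)%E ->
  m `]-oo, 0%R]%classic = 0%E -> (forall x, x <= 0 -> f x = 0) ->
  (forall x, 0 < x -> m `]x, +oo[%classic = (\int[mu]_(y in `]x, +oo[) (f y)%:E)%E) ->
  forall A, measurable A -> m A = (\int[mu]_(y in A) (f y)%:E)%E.
Proof.
move=> mf f0 mfin m0 fneg mtail.
pose nu : {measure set R -> \bar R} := density_measure mf f0.
have nuE A : nu A = (\int[mu]_(y in A) (f y)%:E)%E by [].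
have nu0 : nu `]-oo, 0%R]%classic = 0%E.
  rewrite nuE; apply: integral0_eq => x /=; rewrite in_itv/= => x0.
  by rewrite fneg.
(* The hypothesis on tails leaves out x = 0, which is reached by continuity from below along
   ]1/(n+1), +oo[. *)
have pos : m `]0%R, +oo[%classic = nu `]0%R, +oo[%classic.
  pose F n : set R := `]n.+1%:R^-1, +oo[%classic.
  have UF : \bigcup_n F n = `]0%R, +oo[%classic.
    apply/seteqP; split => x.
      move=> [n _]; rewrite /F/= !in_itv/= !andbT; apply: lt_trans.
      by rewrite invr_gt0.
    rewrite /= in_itv/= andbT => x0.
    exists (Num.bound x^-1) => //; rewrite /F/= in_itv/= andbT.
    rewrite -[ltRHS]invrK ltf_pV2 ?posrE ?invr_gt0//.
    apply: (@lt_le_trans _ _ (Num.bound x^-1)%:R); last by rewrite ler_nat.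
    by apply: archi_boundP; rewrite invr_ge0 ltW.
  have mF n : measurable (F n) by exact: measurable_itv.
  have mUF : measurable (\bigcup_n F n) by exact: bigcupT_measurable.
  have ndF : nondecreasing_seq F.
    move=> i j ij; apply/subsetPset => x; rewrite /F/= !in_itv/= !andbT.
    by apply: le_lt_trans; rewrite lef_pV2 ?posrE// ler_nat.
  have c1 := nondecreasing_cvg_mu (mu := m) mF mUF ndF.
  have c2 := nondecreasing_cvg_mu (mu := nu) mF mUF ndF.
  have e : m \o F = nu \o F.
    by apply/funext => n /=; rewrite nuE mtail// invr_gt0.
  rewrite -UF; move: c1; rewrite e => c1.
  exact: (cvg_unique _ c1 c2).
pose G := [set A : set R | exists x, A = `]x, +oo[%classic].
have GE A : G A -> m A = nu A.
  move=> [x ->]; have [x0|x0] := leP x 0; last by rewrite mtail.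
  have xE : `]x, +oo[%classic = `]x, 0]%classic `|` `]0%R, +oo[%classic :> set R.
    by rewrite -itv_bndbnd_setU// bnd_simp.
  have z (k : {measure set R -> \bar R}) : k `]-oo, 0%R]%classic = 0%E ->
      k `]x, +oo[%classic = k `]0%R, +oo[%classic.
    move=> k0; rewrite xE measureU//; last first.
      rewrite -subset0 => y/=; rewrite !in_itv/= andbT => -[/andP[_ h1] h2].
      by move: (le_lt_trans h1 h2); rewrite ltxx.
    rewrite -[RHS]add0e; congr (_ + _)%E.
    apply/eqP; rewrite -measure_le0 -k0; apply: le_measure.
    - by rewrite inE; exact: measurable_itv.
    - by rewrite inE; exact: measurable_itv.
    - by move=> y /=; rewrite !in_itv/= => /andP[].
  by rewrite (z m m0) (z nu nu0).
move=> A mA; rewrite -nuE.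
apply: (measure_unique G (fun n => `](- n%:R), +oo[%classic)) => //.
- exact: RGenOInfty.measurableE.
- move=> _ _ [x ->] [y ->]; exists (Num.max x y).
  apply/seteqP; split => z /=; rewrite !in_itv/= !andbT gt_max.
    by move=> [-> ->].
  by move=> /andP[].
- by move=> n; exists (- n%:R).
- apply/seteqP; split => // x _; exists (Num.bound `|x|) => //=.
  rewrite in_itv/= andbT ltrNl.
  by apply: le_lt_trans (archi_boundP (normr_ge0 x)); rewrite -normrN ler_norm.
- move=> n; apply: le_lt_trans mfin; apply: le_measure => //.
  + by rewrite inE; exact: measurable_itv.
  + by rewrite inE.
Qed.

(** Otherwise f - g stays above half its value at x on a short interval to the right of x, where its
    integral vanishes. *)
Lemma continuous_density_unique (f g : R -> R) (x : R) :
  0 < x ->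
  (forall y, 0 < y -> {for y, continuous f}) ->
  (forall y, 0 < y -> {for y, continuous g}) ->
  (forall A : set R, measurable A ->
    (\int[mu]_(y in A) (f y)%:E)%E = (\int[mu]_(y in A) (g y)%:E)%E) ->
  f x <= g x.
Proof.
move=> x0 cf cg fg; rewrite leNgt; apply/negP => gf.
pose e := (f x - g x) / 2.
have e0 : 0 < e by rewrite divr_gt0// subr_gt0.
have c : {for x, continuous (fun y => f y - g y)}.
  by apply: cvgB; [exact: cf|exact: cg].
have /cvgrPdist_le/(_ _ e0) [d /= d0 H] := c.
pose J : set R := `[x, x + d / 2]%classic.
have Jpos y : y \in `[x, x + d / 2] -> 0 < y.
  by rewrite in_itv/= => /andP[xy _]; exact: lt_le_trans xy.
have fi : mu.-integrable J (EFin \o f).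
  by apply: Rintegrable_itv => y /Jpos; exact: cf.
have gi : mu.-integrable J (EFin \o g).
  by apply: Rintegrable_itv => y /Jpos; exact: cg.
have mJ : measurable J by exact: measurable_itv.
have I0 : (\int[mu]_(y in J) (f y - g y))%R = 0.
  by rewrite RintegralB// /Rintegral fg// subrr.
have I1 : e * (d / 2) <= (\int[mu]_(y in J) (f y - g y))%R.
  have -> : e * (d / 2) = (\int[mu]_(y in J) (fun=> e) y)%R.
    rewrite Rintegral_cst//; congr (_ * _).
    transitivity (fine (d / 2)%:E) => //; congr fine; apply/esym.
    have muJ : mu J = (d / 2)%:E.
      rewrite /J lebesgue_measure_itv/= lte_fin ltrDl divr_gt0// -EFinD.
      by rewrite addrAC subrr add0r.
    exact: muJ.
  apply: le_Rintegral => //.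
  - by apply: Rintegrable_itv => y _; exact: cst_continuous.
  - exact: RintegrableB.
  - move=> y; rewrite /J/= in_itv/= => /andP[xy yd].
    have hb : `|x - y| < d by rewrite ler0_norm ?subr_le0// opprB; lra.
    have /ler_normlP[_] := H y hb.
    by rewrite /e; lra.
by move: I1; rewrite I0 leNgt mulr_gt0// divr_gt0.
Qed.

End density_of_tails.

(** * The Laplace transform of a distribution function *)

Lemma measurable_cdf_set d (T : measurableType d) (R : realType)
    (P : probability T R) (X : {RV P >-> R}) (t : R) :
  measurable [set w | X w <= t].
Proof.
rewrite (_ : [set w | X w <= t] = X @^-1` `]-oo, t]%classic).
  rewrite -[X in measurable X]setTI.
  by apply: (measurable_funPT X) => //; exact: measurable_itv.
by apply/seteqP; split => w /=; rewrite in_itv.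
Qed.

Section laplace_cdf.
Context {R : realType} d (T : measurableType d) (P : probability T R).
Local Notation mu := (@lebesgue_measure R).
Local Notation D := (`]0%R, +oo[%classic : set R).

Lemma integral_expRN_tail (s a : R) : 0 < s ->
  (\int[mu]_(t in `[a, +oo[) (expR (- (s * t)))%:E =
   (s^-1 * expR (- (s * a)))%:E)%E.
Proof.
move=> s0; pose F t := - (s^-1 * expR (- (s * t))).
have dF (t : R) : is_derive t 1 F (expR (- (s * t))).
  by rewrite /F; deriv => /=; field; rewrite gt_eqF.
transitivity (0%:E - (F a)%:E)%E; last by rewrite /F -EFinN opprK add0e.
apply: (@ge0_continuous_FTC2y _ (fun t => expR (- (s * t))) F a 0).
- by move=> t _; exact: expR_ge0.
- apply: continuous_in_subspaceT => t _.
  suff : {for t, continuous (fun t : R => expR (- (s * t)))} by [].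
  by eapply is_derive_continuous; repeat deriv_step.
- rewrite /F -oppr0 -[X in - X](mulr0 s^-1); apply: cvgN; apply: cvgMr.
  have st : (s * t) @[t --> +oo] --> +oo.
    rewrite (_ : (fun t => s * t) = (fun t => t * s)); last first.
      by apply/funext => t; rewrite mulrC.
    by apply: gt0_cvgMly => //; exact: cvg_id.
  exact: (cvg_comp _ _ st (@cvgr_expR R)).
- by move=> t _; have [] := dF t.
- by apply/cvg_at_right_filter; exact: is_derive_continuous (dF a).
- by move=> t _; rewrite derive1E; have [_ ->] := dF t.
Qed.

(** Tonelli on the set 0 < t, X <= t: integrating e^{-s t} over t first gives e^{-s X} / s,
    integrating over the sample space first gives the distribution function. *)
Lemma laplace_cdf (X : {RV P >-> R}) (s e : R) : 0 < s ->
  (forall w, 0 <= X w) -> ('E_P[fun w => expR (- s * X w)] = e%:E)%E ->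
  (\int[mu]_(t in D) (expR (- (s * t)) * fine (P [set w | X w <= t])))%R =
  s^-1 * e.
Proof.
move=> s0 X0 Ee.
have mX : measurable_fun setT X by exact: measurable_funPT.
have mXle t : measurable [set w | X w <= t] by exact: measurable_cdf_set.
pose A : set (T * R) := [set z | 0 < z.2 /\ X z.1 <= z.2].
have mA : measurable A.
  have -> : A = (fun z : T * R => z.2) @^-1` `]0%R, +oo[%classic `&`
     (fun z : T * R => X z.1 - z.2) @^-1` `]-oo, 0%R]%classic.
    apply/seteqP; split => z /=; rewrite !in_itv/= andbT subr_le0; case=> //.
  apply: measurableI; rewrite -[X in measurable X]setTI.
    by apply: (measurable_snd measurableT); exact: measurable_itv.
  have mg : measurable_fun setT (fun z : T * R => X z.1 - z.2).
    apply: measurable_funB; last exact: measurable_snd.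
    exact: (measurableT_comp mX measurable_fst).
  by apply: (mg measurableT); exact: measurable_itv.
pose f (z : T * R) : \bar R := (expR (- (s * z.2)) * \1_A z)%:E.
have mf : measurable_fun setT f.
  apply/measurable_EFinP; apply: measurable_funM; last exact: measurable_indic.
  apply: (measurableT_comp (@measurable_expR R)).
  have -> : (fun z : T * R => - (s * z.2)) = (fun z : T * R => (- s) * z.2).
    by apply/funext => z; rewrite mulNr.
  by apply: measurable_funM => //; exact: measurable_snd.
have f0 z : (0 <= f z)%E by rewrite lee_fin mulr_ge0 ?expR_ge0.
have := @fubini_tonelli _ _ _ _ R P mu f mf f0.
have -> : (fun w => \int[mu]_t f (w, t))%E =
    (fun w => (s^-1)%:E * (expR (- s * X w))%:E)%E.
  apply/funext => w.
  pose B : set R := [set t | 0 < t /\ X w <= t].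
  have -> : (\int[mu]_t f (w, t) = \int[mu]_(t in B) (expR (- (s * t)))%:E)%E.
    rewrite [RHS]integral_mkcond; apply: eq_integral => t _.
    rewrite /f indicE patchE.
    rewrite (_ : ((w, t) \in A) = (t \in B)); last first.
      by apply/idP/idP; rewrite !inE.
    by case: ifP => _; rewrite ?mulr1 ?mulr0.
  rewrite mulNr -EFinM -integral_expRN_tail//.
  (* [B] is the closed half-line from X w if X w > 0; if X w = 0 it lacks the point 0, a null
     set. *)
  have [Xw|Xw] := ltP 0 (X w).
    congr (\int[mu]_(t in _) _)%E; apply/seteqP; split => t /=.
      by rewrite in_itv/= andbT => -[].
    by rewrite in_itv/= andbT => Xt; split => //; exact: lt_le_trans Xt.
  have -> : X w = 0 by apply/eqP; rewrite eq_le Xw X0.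
  rewrite -integral_itv_obnd_cbnd; last first.
    apply/measurable_EFinP; apply: continuous_measurable_itv => t _.
    by eapply is_derive_continuous; repeat deriv_step.
  congr (\int[mu]_(t in _) _)%E; apply/seteqP; split => t /=.
    by rewrite in_itv/= andbT => -[].
  rewrite in_itv/= andbT => t0; split => //.
  by apply: le_trans (ltW t0).
have -> : (fun t => \int[P]_w f (w, t))%E =
    (fun t => (((fun t => expR (- (s * t)) * fine (P [set w | X w <= t])) \_ D) t)%:E).
  apply/funext => t; rewrite patchE.
  have [t0|t0] := boolP (t \in D); last first.
    rewrite (_ : (fun w => f (w, t)) = cst 0%E) ?integral0//; apply/funext => w.
    rewrite /f indicE memNset ?mulr0// => -[] /= tpos _.
    by move: t0; rewrite notin_setE /= in_itv/= andbT.
  have {}t0 : 0 < t by move: t0; rewrite inE/= in_itv/= andbT.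
  have -> : (fun w => f (w, t)) =
      (fun w => (expR (- (s * t)))%:E * (\1_[set w | X w <= t] w)%:E)%E.
    apply/funext => w; rewrite /f EFinM !indicE; congr (_ * (_%:R)%:E)%E.
    by congr nat_of_bool; apply/idP/idP; rewrite !inE /A /=; [case|split].
  rewrite ge0_integralZl_EFin ?expR_ge0//; first last.
  - by apply/measurable_EFinP; exact: measurable_indic.
  by rewrite integral_indic// setIT EFinM fineK// fin_num_measure.
rewrite ge0_integralZl_EFin ?invr_ge0 ?(ltW s0)//; first last.
- apply/measurable_EFinP; apply: (measurableT_comp (@measurable_expR R)).
  exact: measurable_funM.
have -> : (\int[P]_w (expR (- s * X w))%:E = e%:E)%E.
  by rewrite -Ee unlock.
by move=> H; rewrite Rintegral_mkcond /Rintegral -H.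
Qed.

Lemma fine_cdfE (X : {RV P >-> R}) (t : R) :
  fine (P [set w | X w <= t]) = fine (cdf X t).
Proof.
by congr fine; rewrite /cdf /distribution /pushforward; congr (P _).
Qed.

Lemma measurable_fine_cdf (X : {RV P >-> R}) :
  measurable_fun setT (fun t => fine (P [set w | X w <= t])).
Proof.
under eq_fun do rewrite fine_cdfE.
apply: nondecreasing_measurable => //=.
by move=> u v uv; rewrite fine_le ?fin_num_measure// cdf_nondecreasing.
Qed.

Lemma right_continuous_fine_cdf (X : {RV P >-> R}) (t : R) :
  fine (P [set w | X w <= u]) @[u --> t^'+] --> fine (P [set w | X w <= t]).
Proof.
rewrite fine_cdfE; under eq_fun do rewrite fine_cdfE.
apply: fine_cvg; rewrite fineK; first exact: cdf_right_continuous.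
exact: fin_num_measure.
Qed.

Lemma fine_cdf_bounded (X : {RV P >-> R}) (t : R) :
  `|fine (P [set w | X w <= t])| <= 1.
Proof.
rewrite fine_cdfE ger0_norm ?fine_ge0 ?cdf_ge0//.
rewrite -lee_fin fineK ?cdf_le1//; exact: fin_num_measure.
Qed.

End laplace_cdf.

(** * The inverse process: measurability, positivity, comparison of events *)

Lemma measurable_fun_fine {R : realType} :
  measurable_fun setT (fine : \bar R -> R).
Proof.
move=> _ A mA; rewrite setTI.
(* [fine] sends both infinities to 0, so they lie in the preimage exactly when 0 is in A. *)
have -> : fine @^-1` A =
    EFin @` A `|` [set x : \bar R | (x = +oo \/ x = -oo)%E /\ A 0].
  apply/seteqP; split => [[r| |]|[r| |]] /=.
  - by move=> Ar; left; exists r.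
  - by move=> A0; right; split; [left|].
  - by move=> A0; right; split; [right|].
  - by move=> [[a Aa [<-]]//|[[]//]].
  - by move=> [[]//|[]].
  - by move=> [[]//|[]].
apply: measurableU; first exact: measurable_image_EFin.
have [A0|A0] := pselect (A 0).
  rewrite (_ : [set x | _] = [set +oo%E] `|` [set -oo%E]); first exact: measurableU.
  by apply/seteqP; split => x /=; [case|split].
rewrite (_ : [set x | _] = set0)//.
by apply/seteqP; split => x //= -[].
Qed.

Section inverse_process_tail.
Context {R : realType} {d : measure_display} {Omega : measurableType d}.
Context {P : probability Omega R} {D : R -> {RV P >-> R}}.
Hypothesis hD : subordinator D.
Variable t : R.
Hypothesis t0 : 0 < t.

Local Notation E := (inverse_process D t).

Lemma subordinator_ge0 x w : 0 <= x -> 0 <= D x w.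
Proof.
by move=> x0; rewrite -(subordinator_start hD w) (subordinator_nondecreasing hD).
Qed.

(** Together with [inverse_process_ge] this nests the events E > x, D x <= t and E >= x, so they
    differ only where E = x. *)
Lemma inverse_process_gt x w : 0 < x -> (x%:E < E w)%E -> D x w <= t.
Proof.
move=> x0; apply: contraTT; rewrite -!ltNge -leNgt => tx.
by apply: ereal_inf_lbound; exists x.
Qed.

Lemma inverse_process_ge x w : D x w <= t -> (x%:E <= E w)%E.
Proof.
move=> xt; apply: le_ereal_inf_tmp => _ [u [u0 tu] <-]; rewrite lee_fin leNgt.
apply/negP => ux; move: tu; rewrite ltNge; apply/negP; rewrite negbK.
by apply: le_trans xt; apply: (subordinator_nondecreasing hD); exact: ltW.
Qed.

(** Right continuity at 0, where D vanishes, keeps D below t for a short time. This puts the law on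
    the positive side and excludes -oo. *)
Lemma inverse_process_gt0 w : (0 < E w)%E.
Proof.
have := @subordinator_right_continuous _ _ _ _ _ hD w 0 (lexx 0).
rewrite (subordinator_start hD) => /cvgrPdist_lt/(_ _ t0).
rewrite near_withinE => -[e /= e0 H].
have e2 : 0 < e / 2 by rewrite divr_gt0.
apply: (@lt_le_trans _ _ (e / 2)%:E); first by rewrite lte_fin.
apply: inverse_process_ge; have := H (e / 2).
rewrite /= sub0r normrN gtr0_norm// => /(_ _ e2).
rewrite sub0r normrN => h; apply/ltW/(le_lt_trans (ler_norm _))/h.
by rewrite ltr_pdivrMr// ltr_pMr// ltr1n.
Qed.

Lemma inverse_process_measurable : measurable_fun setT E.
Proof.
apply: (measurability _ (ErealGenInftyO.measurableE R)) => _ [_ [c ->] <-].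
rewrite setTI.
(* A time u < c with D u > t may be raised to a rational below c, since the paths are
   nondecreasing. *)
have -> : E @^-1` `]-oo, c%:E[ =
    \bigcup_(q in [set q : rat | 0 < ratr q :> R /\ ratr q < c])
      (D (ratr q) @^-1` `]t, +oo[%classic).
  apply/seteqP; split => w /=.
    rewrite in_itv/= => /ereal_inf_lt[_ [u [u0 tu] <-]]; rewrite lte_fin => uc.
    have [q] := rat_in_itvoo uc; rewrite in_itv/= => /andP[uq qc].
    have q0 : 0 < ratr q :> R := lt_trans u0 uq.
    exists q => //=; rewrite in_itv/= andbT (lt_le_trans tu)//.
    by apply: (subordinator_nondecreasing hD); exact: ltW.
  move=> [q [q0 qc]] /=; rewrite !in_itv/= andbT => tq.
  apply: (@le_lt_trans _ _ (ratr q)%:E); last by rewrite lte_fin.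
  by apply: ereal_inf_lbound; exists (ratr q).
rewrite bigcup_mkcond; apply: bigcupT_measurable_rat => q; case: ifPn => // _.
rewrite -[X in measurable X]setTI.
by apply: (measurable_funPT (D (ratr q))) => //; exact: measurable_itv.
Qed.

End inverse_process_tail.

(** * An exponential bound for the distribution function *)

Section chernoff.
Context {R : realType} {d : measure_display} {T : measurableType d}.
Context {P : probability T R}.

(** The indicator of X <= t is at most e^{s (t - X)}. Applied to D(x), this makes the tail of E(t)
    vanish at infinity. *)
Lemma cdf_le_laplace (X : {RV P >-> R}) (t s e : R) : 0 < s ->
  ('E_P[fun w => expR (- s * X w)] = e%:E)%E ->
  fine (P [set w | X w <= t]) <= expR (s * t) * e.
Proof.
move=> s0 Ee.
have mX : measurable_fun setT X by exact: measurable_funPT.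
have mA : measurable [set w | X w <= t] by exact: measurable_cdf_set.
rewrite -lee_fin fineK ?fin_num_measure// EFinM -Ee unlock.
have me : measurable_fun setT (fun w => (expR (- s * X w))%:E).
  apply/measurable_EFinP; apply: (measurableT_comp (@measurable_expR R)).
  exact: measurable_funM.
rewrite -ge0_integralZl_EFin ?expR_ge0//.
rewrite -(setIT [set w | X w <= t]) -integral_indic//.
apply: ge0_le_integral => //.
- by apply/measurable_EFinP; exact: measurable_indic.
- by apply: measurable_funeM.
- move=> w _; rewrite -EFinM lee_fin indicE -expRD.
  have [|_] := boolP (w \in _); last by rewrite expR_ge0.
  rewrite inE/= => Xt; apply: le_trans (expR_ge1Dx _).
  rewrite lerDl mulNr -mulrBr mulr_ge0 ?subr_ge0//; exact: ltW.
Qed.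

End chernoff.

(** A density is a function on the whole line; the extension by 0 reflects E(t) > 0. *)
Definition its_density0 {R : realType} (b l t x : R) : R :=
  if 0 < x then its_density b l t x else 0.

(** * The law of the inverse tempered stable subordinator *)

Section ITS.
Context {R : realType} {d : measure_display} {Omega : measurableType d}.
Context {P : probability Omega R} {b l : R} {D : R -> {RV P >-> R}}.
Local Notation mu := (@lebesgue_measure R).
Hypotheses (b0 : 0 < b) (b1 : b < 1) (l0 : 0 < l).
Hypothesis hD : tempered_stable_subordinator b l D.

Let hsub : subordinator D := tempered_stable_is_subordinator hD.

Lemma subordinator_cdf x t : 0 < x -> 0 < t ->
  fine (P [set w | D x w <= t]) = ray_tail b x l pi t.
Proof.
move=> x0 t0; have p0 := pi_gt0 R; have hb0 := b0; have hb1 := b1.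
(* As th0 + b th0 = pi, the requirements th0 > pi / 2 and b th0 < pi / 2 are one and the same, and
   amount to b < 1. *)
pose th0 : R := pi / (1 + b).
have b10 : 0 < 1 + b by rewrite addr_gt0.
have th1 : pi / 2 < th0 by rewrite ltr_pM2l// ltf_pV2 ?posrE//; lra.
have th2 : th0 < pi by rewrite gtr_pMr// invf_lt1//; lra.
have th3 : b * th0 < pi / 2.
  by rewrite /th0 mulrCA ltr_pM2l// ltr_pdivrMr//; lra.
have -> : ray_tail b x l pi t = ray_tail b x l th0 t.
  by rewrite /ray_tail (ray_integral_left b0 b1 x0 t0 l0 th1 (ltW th2)).
have [M HM] := ray_tail_bounded b0 x0 l0 th1 th2 th3.
have X0 w : 0 <= D x w by apply: (subordinator_ge0 hsub); exact: ltW.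
apply: (@laplace_unique _ (fun t => fine (P [set w | D x w <= t]))
  (ray_tail b x l th0) (Num.max 1 M)) => //.
- by apply: measurable_funTS; exact: measurable_fine_cdf.
- by move=> u _; rewrite le_max fine_cdf_bounded.
- apply: continuous_measurable_itv => u; rewrite in_itv/= andbT.
  exact: ray_tail_continuous.
- by move=> u u0; rewrite le_max HM// orbT.
- by move=> u _; exact: right_continuous_fine_cdf.
- by move=> u u0; apply: cvg_at_right_filter; exact: ray_tail_continuous.
move=> s s0; rewrite laplace_ray_tail//.
rewrite (laplace_cdf s0 X0 (tempered_stable_laplace hD (ltW x0) s0)).
by rewrite mulNr.
Qed.

(** Not visible on the oscillating integral; it comes from the probabilistic side, where D(x) <=
    D(y). *)
Lemma ray_tail_nonincreasing t x y : 0 < t -> 0 < x -> x <= y ->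
  ray_tail b y l pi t <= ray_tail b x l pi t.
Proof.
move=> t0 x0 xy; have y0 := lt_le_trans x0 xy.
rewrite -!subordinator_cdf// fine_le ?fin_num_measure//;
  [exact: measurable_cdf_set|exact: measurable_cdf_set|].
apply: le_measure; rewrite ?inE; [exact: measurable_cdf_set|exact: measurable_cdf_set|].
move=> w /=; apply: le_trans.
by apply: (subordinator_nondecreasing hsub) => //; exact: ltW.
Qed.

(* Only strictly decreasing functions have a sign lemma in the library, hence
   the term e * y. *)
Lemma its_density_ge0 t x : 0 < t -> 0 < x -> 0 <= its_density b l t x.
Proof.
move=> t0 x0; rewrite -oppr_le0; apply/ler_addgt0Pl => e e0.
pose g (y : R) := ray_tail b y l pi t - e * y.
have dg (y : R) : 0 < y -> is_derive y 1 g (- its_density b l t y - e).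
  move=> y0; rewrite /g; notypeclasses refine (deriv_eq _ _).
    notypeclasses refine (deriv_sub _ _); first exact: is_derive_ray_tail_pi.
    by repeat deriv_step.
  by rewrite /=; ring.
have : derive1 g x <= 0.
  apply: (@decr_derive1_le0_itvy _ g false 0).
  - by move=> y; rewrite inE/= in_itv/= andbT => /dg[].
  - move=> y z; rewrite !in_itv/= !andbT => y0 z0 zy.
    rewrite /g ler_ltB//; first by apply: ray_tail_nonincreasing => //; exact: ltW.
    by rewrite ltr_pM2l.
  - by rewrite in_itv/= x0.
by rewrite derive1E; have [_ ->] := dg x x0; rewrite subr_le0 addr0.
Qed.

Lemma ray_tail_cvg0 t : 0 < t -> ray_tail b x l pi t @[x --> +oo] --> 0.
Proof.
(* The Laplace exponent psi at s = 1, so that P(D(x) <= t) <= e^{t - c x}. *)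
move=> t0; pose c := (1 + l) `^ b - l `^ b.
have c0 : 0 < c by rewrite subr_gt0 gt0_ltr_powR ?nnegrE ?addr_ge0 ?(ltW l0)// ltrDr.
apply: (@squeeze_cvgr _ _ _ _ (fun=> 0) (fun x => expR t * expR (- (x * c)))).
- near=> x; have x0 : 0 < x by near: x; exact: nbhs_pinfty_gt.
  rewrite -subordinator_cdf// fine_ge0//=.
  have := cdf_le_laplace t ltr01 (tempered_stable_laplace hD (ltW x0) ltr01).
  by rewrite mul1r mulNr.
- exact: cvg_cst.
- rewrite -(mulr0 (expR t)); apply: cvgMr.
  have st : (x * c) @[x --> +oo] --> +oo.
    by apply: gt0_cvgMly => //; exact: cvg_id.
  exact: (cvg_comp _ _ st (@cvgr_expR R)).
Unshelve. all: by end_near. Qed.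

Lemma its_density_tail t x : 0 < t -> 0 < x ->
  (\int[mu]_(y in `]x, +oo[) (its_density b l t y)%:E = (ray_tail b x l pi t)%:E)%E.
Proof.
move=> t0 x0.
have cx (y : R) : x <= y -> {for y, continuous (its_density b l t)}.
  by move=> xy; apply: its_density_continuous => //; exact: lt_le_trans xy.
rewrite integral_itv_obnd_cbnd; last first.
  apply/measurable_EFinP; apply: continuous_measurable_itv => y.
  by rewrite in_itv/= andbT => /ltW; exact: cx.
have dF (y : R) : 0 < y ->
    is_derive y 1 (fun y => - ray_tail b y l pi t) (its_density b l t y).
  move=> y0; rewrite -[its_density _ _ _ _]opprK; notypeclasses refine (deriv_opp _).
  exact: is_derive_ray_tail_pi.
transitivity (0%:E - (- ray_tail b x l pi t)%:E)%E; last by rewrite -EFinN opprK add0e.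
apply: (@ge0_continuous_FTC2y _ (its_density b l t) (fun y => - ray_tail b y l pi t)).
- by move=> y xy; apply: its_density_ge0 => //; exact: lt_le_trans xy.
- apply: continuous_in_subspaceT => y; rewrite inE/= in_itv/= andbT; exact: cx.
- by rewrite -oppr0; apply: cvgN; exact: ray_tail_cvg0.
- by move=> y xy; have [] := dF y (lt_trans x0 xy).
- by apply/cvg_at_right_filter; exact: is_derive_continuous (dF x x0).
- move=> y; rewrite in_itv/= andbT => xy; rewrite derive1E.
  by have [_ ->] := dF y (lt_trans x0 xy).
Qed.

Lemma measurable_gt (E : Omega -> \bar R) (y : R) : measurable_fun setT E ->
  measurable [set w | y%:E < E w]%E.
Proof.
move=> mE; rewrite (_ : [set w | _]%E = E @^-1` `]y%:E, +oo[%classic).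
  by rewrite -[X in measurable X]setTI; apply: mE => //; exact: emeasurable_itv.
by apply/seteqP; split => w /=; rewrite in_itv/= andbT.
Qed.

Lemma inverse_process_tail t x : 0 < t -> 0 < x ->
  P [set w | x%:E < inverse_process D t w]%E = (ray_tail b x l pi t)%:E.
Proof.
move=> t0 x0; set E := inverse_process D t.
have mE : measurable_fun setT E by exact: inverse_process_measurable.
have mgt y : measurable [set w | y%:E < E w]%E by exact: measurable_gt.
pose p := fine (P [set w | x%:E < E w]%E).
suff : p = ray_tail b x l pi t by move=> <-; rewrite fineK ?fin_num_measure.
apply/eqP; rewrite eq_le; apply/andP; split.
  rewrite -subordinator_cdf// fine_le ?fin_num_measure//; [exact: measurable_cdf_set|].
  apply: le_measure; rewrite ?inE//; first exact: measurable_cdf_set.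
  by move=> w; exact: inverse_process_gt.
have c : {for x, continuous (fun x => ray_tail b x l pi t)}.
  exact: is_derive_continuous (is_derive_ray_tail_pi b0 b1 l0 t0 x0).
apply/ler_addgt0Pl => e e0.
have /cvgrPdist_le/(_ _ e0) [dl /= dl0 H] := c.
(* With x' = x + dl / 2, the event D(x') <= t lies in E >= x', hence in E > x, and its probability
   is within e of the tail at x. *)
have xd : 0 < x + dl / 2 by rewrite addr_gt0// divr_gt0.
have hb : `|x - (x + dl / 2)| < dl.
  rewrite opprD addNKr normrN gtr0_norm ?divr_gt0//.
  by rewrite ltr_pdivrMr// ltr_pMr// ltr1n.
have /ler_normlP[_] := H _ hb; rewrite lerBlDr => /le_trans; apply.
rewrite lerD2l -subordinator_cdf// fine_le ?fin_num_measure//; [exact: measurable_cdf_set|].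
apply: le_measure; rewrite ?inE//; first exact: measurable_cdf_set.
move=> w /= wt; apply: lt_le_trans (inverse_process_ge hsub wt).
by rewrite lte_fin ltrDl divr_gt0.
Qed.

Lemma inverse_process_finite t : 0 < t ->
  P [set w | inverse_process D t w = +oo]%E = 0%E.
Proof.
move=> t0; set E := inverse_process D t.
have mE : measurable_fun setT E by exact: inverse_process_measurable.
have my : measurable [set w | E w = +oo]%E.
  rewrite -[X in measurable X]setTI; exact: (mE measurableT [set +oo%E]).
apply/eqP; rewrite -measure_le0 -[leLHS]fineK ?fin_num_measure// lee_fin.
apply/ler_addgt0Pl => e e0; rewrite addr0.
have /cvgrPdist_le/(_ _ e0) [x [_ Hx]] := ray_tail_cvg0 t0.
pose y := Num.max x 0 + 1.
have y0 : 0 < y by rewrite ltr_wpDl// le_max lexx orbT.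
have xy : x < y by rewrite ltr_pwDr// le_max lexx.
apply: le_trans (le_trans (ler_norm _) _); last first.
  by have := Hx y xy; rewrite sub0r normrN; exact.
rewrite -[leRHS]/(fine (ray_tail b y l pi t)%:E) -inverse_process_tail//.
rewrite fine_le ?fin_num_measure//; first exact: measurable_gt.
apply: le_measure; rewrite ?inE//; first exact: measurable_gt.
by move=> w Ew /=; rewrite [X in (_ < X)%E]Ew ltry.
Qed.

Lemma its_density0_density t : 0 < t ->
  is_density P (inverse_process D t) (its_density0 b l t).
Proof.
move=> t0; set E := inverse_process D t.
have mE : measurable_fun setT E by exact: inverse_process_measurable.
have mf : measurable_fun setT (its_density0 b l t).
  rewrite (_ : its_density0 b l t = its_density b l t \_ `]0%R, +oo[%classic).
    apply/(measurable_restrictT _ (measurable_itv _)).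
    apply: continuous_measurable_itv => x; rewrite in_itv/= andbT.
    exact: its_density_continuous.
  apply/funext => x; rewrite patchE /its_density0.
  by rewrite (_ : (x \in _) = (0 < x))//; apply/idP/idP; rewrite inE/= in_itv/= andbT.
have f0 x : 0 <= its_density0 b l t x.
  by rewrite /its_density0; case: ifPn => // x0; exact: its_density_ge0.
split => // A mA.
have mW : measurable_fun setT (fine \o E).
  exact: (measurableT_comp measurable_fun_fine mE).
(* A real random variable that agrees with E off the null set [N]; on [N] it takes the default value
   0, so [N] is removed before events are compared. *)
pose W : {RV P >-> R} := mfun_Sub (mem_set mW).
have mWp (B : set R) : measurable B -> measurable (W @^-1` B).
  by move=> mB; rewrite -[X in measurable X]setTI; exact: (mW measurableT).
pose N := [set w | E w = +oo]%E.
have mN : measurable N.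
  rewrite -[X in measurable X]setTI; exact: (mE measurableT [set +oo%E]).
have N0 : P N = 0%E by exact: inverse_process_finite.
have E0 w : (0 < E w)%E by exact: inverse_process_gt0.
have EW w : ~ N w -> E w = (W w)%:E.
  move=> /eqP Ey; rewrite /= fineK//.
  by rewrite fin_numE Ey andbT gt_eqF// (lt_trans _ (E0 w)).
have PN (S : set Omega) : measurable S -> P S = P (S `\` N).
  move=> mS; have := measureDI P mS mN.
  rewrite [X in (_ + X)%E](_ : _ = 0%E) ?adde0//.
  apply/eqP; rewrite -measure_le0 -N0; apply: le_measure; rewrite ?inE//.
  exact: measurableI.
have -> : E @^-1` (EFin @` A) = W @^-1` A `\` N.
  apply/seteqP; split => w /=.
    by move=> [a Aa aE]; rewrite /N/= -aE.
  by move=> [Aw Nw]; exists (W w) => //; rewrite -EW.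
rewrite -PN; last exact: mWp.
apply: (@measure_eq_density R (distribution P W) (its_density0 b l t)) => //.
- change (P (W @^-1` setT) < +oo)%E.
  by rewrite preimage_setT probability_setT ltry.
- change (P (W @^-1` `]-oo, 0%R]%classic) = 0%E); rewrite PN; last exact: mWp.
  rewrite (_ : _ `\` _ = set0) ?measure0//; apply/seteqP; split => w //=.
  move=> [Ww Nw]; have := E0 w; rewrite (EW w Nw) lte_fin ltNge.
  by move: Ww; rewrite in_itv/= => ->.
- by move=> x x0; rewrite /its_density0 ltNge x0.
- move=> x x0; transitivity (P (W @^-1` `]x, +oo[%classic)); first by [].
  rewrite PN; last exact: mWp.
  have -> : W @^-1` `]x, +oo[ `\` N = [set w | x%:E < E w]%E `\` N.
    apply/seteqP; split => w /=; rewrite in_itv/= andbT => -[Ww Nw]; split => //.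
      by rewrite (EW w Nw) lte_fin.
    by move: Ww; rewrite (EW w Nw) lte_fin.
  rewrite -PN; last exact: measurable_gt.
  rewrite inverse_process_tail// -its_density_tail//.
  apply: eq_integral => y; rewrite inE/= in_itv/= andbT => xy.
  by rewrite /its_density0 (lt_trans x0 xy).
Qed.

End ITS.

Theorem theorem2p1 (R : realType) (d : measure_display)
    (Omega : measurableType d) (P : probability Omega R) (beta lambda : R)
    (D : R -> {RV P >-> R})
    (hbeta0 : 0 < beta) (hbeta1 : beta < 1) (hlambda : 0 < lambda)
    (hD : tempered_stable_subordinator beta lambda D) :
  (exists h : R -> R -> R, is_ITS_density D h) /\
  (forall h : R -> R -> R, is_ITS_density D h ->
   forall x t : R, 0 < x -> 0 < t ->
   ((h x t)%:E =
    (1 / pi * expR (lambda `^ beta * x - lambda * t))%:E *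
    \int[@lebesgue_measure R]_(y in `]0%R, +oo[)
      (expR (- t * y - x * y `^ beta * cos (beta * pi)) / (y + lambda) *
       (lambda `^ beta * sin (x * y `^ beta * sin (beta * pi)) +
        y `^ beta * sin (beta * pi - x * y `^ beta * sin (beta * pi))))%:E)%E).
Proof.
have dens t : 0 < t ->
    is_density P (inverse_process D t) (its_density0 beta lambda t).
  by move=> t0; exact: its_density0_density.
have cont t x : 0 < t -> 0 < x ->
    {for x, continuous (its_density0 beta lambda t)}.
  move=> t0 x0; have c := its_density_continuous hbeta0 hbeta1 hlambda t0 x0.
  (* Near x > 0 the case distinction in [its_density0] is constant. *)
  rewrite /prop_for /continuous_at /its_density0 x0.
  apply: cvg_trans c; apply: near_eq_cvg; near=> y.
  suff -> : 0 < y by [].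
  by near: y; exact: lt_nbhsr.
split.
  exists (fun x t => its_density0 beta lambda t x) => t t0; split.
    exact: dens.
  by move=> x x0; exact: cont.
move=> h hh x t x0 t0; have [[mh h0 hA] hc] := hh t t0.
have [mf f0 fA] := dens t t0.
have hE : h x t = its_density0 beta lambda t x.
  apply/eqP; rewrite eq_le; apply/andP; split.
    apply: (@continuous_density_unique R (h^~ t) (its_density0 beta lambda t)) => //.
      by move=> y; exact: cont.
    by move=> A mA; rewrite -hA// fA.
  apply: (@continuous_density_unique R (its_density0 beta lambda t) (h^~ t)) => //.
    by move=> y; exact: cont.
  by move=> A mA; rewrite -hA// fA.
rewrite hE /its_density0 x0 /its_density EFinM; congr (_ * _)%E.
(* Integrability makes the extended-real integral of the statement finite, hence equal to the real
   one. *)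
rewrite /Rintegral fineK; first by [].
by apply: integrable_fin_num => //; exact: its_integrand_integrable.
Unshelve. all: by end_near. Qed.
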